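(* Let $\phi$ be a semiconcave function on $M$, $H:T^*M\to\mathbb{R}$ an admissible Hamiltonian, and $\mathbf{p}$ a Borel measurable selection of $D^+\phi$. If $\gamma:I\to M$ is a maximal slope curve for the pair $(\phi,H)$ and the selection $\mathbf{p}$, where $I$ is any interval, then $\gamma$ is a strict singular characteristic for the pair $(\phi,H)$. In other words, if $\gamma$ is a solution of the differential inclusion $\dot\gamma(t)\in H_p(\gamma(t),D^+\phi(\gamma(t)))$ for a.e. $t\in I$, then $\gamma$ is a solution of $\dot\gamma(t)=H_p(\gamma(t),\mathbf{p}^{\#}_{\phi,H}(\gamma(t)))$ for a.e. $t\in I$.
   Context: $M$ is a smooth, compact, connected manifold without boundary with a Riemannian metric and distance $d$. $\phi:M\to\mathbb{R}$ is semiconcave if there is a nondecreasing upper semicontinuous $\omega:[0,\infty)\to[0,\infty)$ with $\lim_{r\to0^+}\omega(r)=0$ such that $\lambda\phi(x)+(1-\lambda)\phi(y)-\phi(\gamma(\lambda))\leq\lambda(1-\lambda)d(x,y)\,\omega(d(x,y))$ for all $x,y$, $\lambda\in[0,1]$ and every geodesic $\gamma:[0,1]\to M$ joining $x$ and $y$ (parametrized so that $\gamma(\lambda)$ plays the role of the convex combination with weights $\lambda,1-\lambda$). $D^+\phi(x)=\{D\psi(x): r>0,\psi\in C^1(B_r(x)),\psi\geq\phi,\psi(x)=\phi(x)\}$. $H$ is admissible if: $H$ is locally Lipschitz; $p\mapsto H(x,p)$ is differentiable and $(x,p)\mapsto H_p(x,p)$ is continuous; $p\mapsto H(x,p)$ is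 strictly convex and $\lim_{|p|_x\to\infty}H(x,p)/|p|_x=+\infty$ uniformly in $x$. $L(x,v)=\sup_p\{\langle p,v\rangle-H(x,p)\}$. A locally absolutely continuous curve $\gamma:I\to M$ is a maximal slope curve for $(\phi,H)$ and a Borel selection $\mathbf{p}$ of $D^+\phi$ if $\phi(\gamma(t_2))-\phi(\gamma(t_1))=\int_{t_1}^{t_2}\{L(\gamma,\dot\gamma)+H(\gamma,\mathbf{p}(\gamma))\}\,ds$ for all $t_1<t_2$ in $I$; equivalently $\dot\gamma(t)=H_p(\gamma(t),\mathbf{p}(\gamma(t)))$ for a.e. $t\in I$. $\mathbf{p}^{\#}_{\phi,H}(x)$ is the unique minimizer of $H(x,\cdot)$ on $D^+\phi(x)$; a strict singular characteristic is a maximal slope curve for the selection $\mathbf{p}^{\#}_{\phi,H}$. Solutions of differential inclusions/equations are locally absolutely continuous curves. *)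

(* Defs.v *)
From mathcomp Require Export all_boot all_order all_algebra.
From mathcomp Require Export all_classical all_reals all_analysis.
Export Order.TTheory GRing.Theory Num.Theory.
Export numFieldNormedType.Exports.

Set Implicit Arguments.
Unset Strict Implicit.
Unset Printing Implicit Defensive.

Local Open Scope classical_set_scope.
Local Open Scope ring_scope.

Section Calculus.
Context {R : realType}.

(* C^k on an open set [U] of R^n, by iterated partial derivatives. *)
Fixpoint Ck_on (n k : nat) (V : normedModType R) (U : set 'rV[R]_n)
    (f : 'rV[R]_n -> V) : Prop :=
  match k with
  | 0 => forall y, U y -> {for y, continuous f}
  | k'.+1 => (forall y, U y -> differentiable f y) /\
      forall i : 'I_n, Ck_on k' U (fun y => 'D_(delta_mx 0 i) f y)
  end.

Definition smooth_on (n : nat) (V : normedModType R) (U : set 'rV[R]_n)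
    (f : 'rV[R]_n -> V) : Prop := forall k, Ck_on k U f.

Definition grad (n : nat) (f : 'rV[R]_n -> R) (y : 'rV[R]_n) : 'rV[R]_n :=
  \row_i 'D_(delta_mx 0 i) f y.

Definition pairing (n : nat) (p v : 'rV[R]_n) : R := (p *m v^T) 0 0.

Definition absolutely_continuous (V : normedModType R) (a b : R) (f : R -> V)
    : Prop :=
  forall e : R, 0 < e -> exists2 d : R, 0 < d &
    forall s : seq (R * R),
      all (fun u => [&& a <= u.1, u.1 <= u.2 & u.2 <= b]) s ->
      pairwise (fun u w => u.2 <= w.1) s ->
      \sum_(u <- s) (u.2 - u.1) < d ->
      \sum_(u <- s) `|f u.2 - f u.1| < e.

End Calculus.

(* [cmap] and [cinv] are total functions; only their values on [cdom] and
   [ccod] are meaningful. *)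
Record chart (R : realType) (n : nat) (M : topologicalType) := Chart {
  cdom : set M;
  ccod : set 'rV[R]_n;
  cmap : M -> 'rV[R]_n;
  cinv : 'rV[R]_n -> M;
  cdom_open : open cdom;
  ccod_open : open ccod;
  cmap_cod : forall x, cdom x -> ccod (cmap x);
  cinv_dom : forall y, ccod y -> cdom (cinv y);
  cmapK : forall x, cdom x -> cinv (cmap x) = x;
  cinvK : forall y, ccod y -> cmap (cinv y) = y;
  cmap_continuous : forall x, cdom x -> {for x, continuous cmap};
  cinv_continuous : forall y, ccod y -> {for y, continuous cinv}
}.

(* Smooth n-manifolds without boundary. Second countability is not listed: it
   follows from compactness, which the theorem assumes. Every point [x] comes
   with a preferred chart [chart_at x]; throughout, a vector of T_x M is given
   by its coordinates in [chart_at x], and a covector of T*_x M by its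
   coordinates in the dual basis, so both are elements of 'rV[R]_n. *)
Record manifold (R : realType) (n : nat) := Manifold {
  mcarrier :> topologicalType;
  atlas : set (chart R n mcarrier);
  chart_at : mcarrier -> chart R n mcarrier;
  chart_at_atlas : forall x, atlas (chart_at x);
  chart_at_dom : forall x, cdom (chart_at x) x;
  atlas_compatible : forall c c', atlas c -> atlas c' ->
    smooth_on [set y | ccod c y /\ cdom c' (cinv c y)] (cmap c' \o cinv c);
  manifold_hausdorff : hausdorff_space mcarrier
}.

Section Coordinates.
Context {R : realType} {n : nat} {M : topologicalType}.
Implicit Types c : chart R n M.

(* If [v] is the coordinate row of a tangent vector at [x] in [c], then
   [v *m chart_change c c' x] is its coordinate row in [c']; hence if [p] is
   the coordinate row of a covector at [x] in [c'], then
   [p *m (chart_change c c' x)^T] is its coordinate row in [c]. *)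
Definition chart_change c c' (x : M) : 'M[R]_n :=
  'J (cmap c' \o cinv c) (cmap c x).

End Coordinates.

(* [gram x] is the Gram matrix of the scalar product of T_x M in [chart_at x];
   smoothness of the metric is that of its Gram matrix in each chart. *)
Record riemannian_manifold (R : realType) (n : nat) := RiemannianManifold {
  rcarrier :> manifold R n;
  gram : rcarrier -> 'M[R]_n;
  gram_sym : forall x, (gram x)^T = gram x;
  gram_posdef : forall x (v : 'rV[R]_n), v != 0 -> 0 < (v *m gram x *m v^T) 0 0;
  gram_smooth : forall c, atlas c ->
    smooth_on (ccod c) (fun y => let x := cinv c y in
      let J := chart_change c (chart_at x) x in J *m gram x *m J^T)
}.

Section Riemannian.
Context {R : realType} {n : nat} {M : riemannian_manifold R n}.

Definition tnorm (x : M) (v : 'rV[R]_n) : R :=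
  Num.sqrt ((v *m gram x *m v^T) 0 0).

Definition conorm (x : M) (p : 'rV[R]_n) : R :=
  Num.sqrt ((p *m invmx (gram x) *m p^T) 0 0).

Definition velocity (g : R -> M) (t : R) : 'rV[R]_n :=
  derive1 (cmap (chart_at (g t)) \o g) t.

Definition has_velocity (g : R -> M) (t : R) (v : 'rV[R]_n) : Prop :=
  is_derive t (1 : R) (cmap (chart_at (g t)) \o g) v.

Definition C1_curve (g : R -> M) : Prop :=
  continuous g /\
  forall c, atlas c -> forall t, cdom c (g t) ->
    derivable (cmap c \o g) t 1 /\ {for t, continuous (derive1 (cmap c \o g))}.

Definition curve_length (g : R -> M) : R :=
  (\int[lebesgue_measure]_(t in `[0%R, 1%R]) tnorm (g t) (velocity g t))%R.

(* [pw_C1_path x y l]: some concatenation of finitely many C^1 arcs (each one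
   the restriction to [0, 1] of a C^1 curve) goes from [x] to [y] and has
   total length [l]. *)
Inductive pw_C1_path : M -> M -> R -> Prop :=
| pw_nil x : pw_C1_path x x 0
| pw_cons (g : R -> M) y l : C1_curve g -> pw_C1_path (g 1) y l ->
    pw_C1_path (g 0) y (curve_length g + l).

Definition rdist (x y : M) : R := inf [set l | pw_C1_path x y l].

(* Minimizing geodesics on [0, 1], parametrized with constant speed. *)
Definition geodesic (g : R -> M) : Prop :=
  forall s t : R, 0 <= s <= 1 -> 0 <= t <= 1 ->
    rdist (g s) (g t) = `|s - t| * rdist (g 0) (g 1).

Definition semiconcave_modulus (w : R -> R) : Prop :=
  [/\ forall r, 0 <= r -> 0 <= w r,
      forall r s, 0 <= r -> r <= s -> w r <= w s,
      forall r a, 0 <= r -> w r < a -> \forall s \near r, 0 <= s -> w s < a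
    & w r @[r --> 0^'+] --> (0 : R)].

Definition semiconcave (phi : M -> R) : Prop :=
  exists2 w, semiconcave_modulus w &
    forall (x y : M) (g : R -> M) (lam : R), 0 <= lam <= 1 ->
      geodesic g -> g 0 = y -> g 1 = x ->
      lam * phi x + (1 - lam) * phi y - phi (g lam)
        <= lam * (1 - lam) * rdist x y * w (rdist x y).

Definition C1_on (O : set M) (psi : M -> R) : Prop :=
  forall c, atlas c ->
    Ck_on 1 [set y | ccod c y /\ O (cinv c y)] (psi \o cinv c).

Definition differential (psi : M -> R) (x : M) : 'rV[R]_n :=
  grad (psi \o cinv (chart_at x)) (cmap (chart_at x) x).

Definition superdifferential (phi : M -> R) (x : M) : set 'rV[R]_n :=
  [set q | exists (r : R) (psi : M -> R),
    [/\ 0 < r,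
        C1_on [set y | rdist x y < r] psi,
        (forall y, rdist x y < r -> phi y <= psi y),
        psi x = phi x
      & q = differential psi x]].

Definition selection (phi : M -> R) (p : M -> 'rV[R]_n) : Prop :=
  forall x, superdifferential phi x (p x).

(* Borel measurability of a section of T*M, read in the trivializations of
   T*M induced by the charts. *)
Definition borel_section (p : M -> 'rV[R]_n) : Prop :=
  forall c, atlas c -> forall U : set 'rV[R]_n, open U ->
    <<s [set A : set M | open A] >>
      [set x | cdom c x /\ U (p x *m (chart_change c (chart_at x) x)^T)].

Definition locally_AC (I : interval R) (g : R -> M) : Prop :=
  {within [set` I], continuous g} /\
  forall c, atlas c -> forall a b, a \in I -> b \in I ->
    (forall t, a <= t <= b -> cdom c (g t)) ->
    absolutely_continuous a b (cmap c \o g).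

(* A function on T*M is given as [H x p] with [p] the coordinates of the
   covector in [chart_at x]; [ham_in_chart H c (y, p)] is the same function in
   the chart of T*M induced by [c]. *)
Definition ham_in_chart (H : M -> 'rV[R]_n -> R) (c : chart R n M)
    (z : 'rV[R]_n * 'rV[R]_n) : R :=
  let x := cinv c z.1 in H x (z.2 *m (chart_change (chart_at x) c x)^T).

Record admissible (H : M -> 'rV[R]_n -> R) : Prop := Admissible {
  ham_lipschitz : forall c, atlas c ->
    forall z : 'rV[R]_n * 'rV[R]_n, ccod c z.1 ->
    exists2 U : set ('rV[R]_n * 'rV[R]_n), nbhs z U &
      [lipschitz ham_in_chart H c w | w in U];
  ham_differentiable : forall x p, differentiable (H x) p;
  ham_grad_continuous : forall c, atlas c -> forall z, ccod c z.1 ->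
    {for z, continuous (fun z : 'rV[R]_n * 'rV[R]_n =>
      grad (fun p => ham_in_chart H c (z.1, p)) z.2)};
  ham_strictly_convex : forall x (p q : 'rV[R]_n) (t : R),
    p != q -> 0 < t < 1 ->
    H x (t *: p + (1 - t) *: q) < t * H x p + (1 - t) * H x q;
  ham_superlinear : forall K : R, exists r : R, forall x p,
    r <= conorm x p -> K * conorm x p <= H x p
}.

Definition lagrangian (H : M -> 'rV[R]_n -> R) (x : M) (v : 'rV[R]_n) : \bar R :=
  ereal_sup [set (pairing p v - H x p)%:E | p in setT].

(* H_p(x, p), a vector of T_x M. *)
Definition ham_p (H : M -> 'rV[R]_n -> R) (x : M) (p : 'rV[R]_n) : 'rV[R]_n :=
  grad (H x) p.

(* [gamma] is only relevant on [I]. The integral is a genuine Lebesgue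
   integral, hence the completed Lebesgue measure. *)
Definition maximal_slope_curve (H : M -> 'rV[R]_n -> R) (phi : M -> R)
    (p : M -> 'rV[R]_n) (I : interval R) (gamma : R -> M) : Prop :=
  locally_AC I gamma /\
  forall t1 t2 : R, t1 \in I -> t2 \in I -> t1 < t2 ->
    let f s := (lagrangian H (gamma s) (velocity gamma s)
                + (H (gamma s) (p (gamma s)))%:E)%E in
    completed_lebesgue_measure.-integrable `[t1, t2] f /\
    (phi (gamma t2) - phi (gamma t1))%:E =
      (\int[completed_lebesgue_measure]_(s in `[t1, t2]) f s)%E.

(* Where it exists, the minimizer is unique since H(x, .) is strictly convex
   and the superdifferential is convex. *)
Definition psharp (H : M -> 'rV[R]_n -> R) (phi : M -> R) (x : M) : 'rV[R]_n :=
  get [set q | superdifferential phi x q /\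
    forall q', superdifferential phi x q' -> H x q <= H x q'].

Definition strict_singular_characteristic (H : M -> 'rV[R]_n -> R)
    (phi : M -> R) (I : interval R) (gamma : R -> M) : Prop :=
  maximal_slope_curve H phi (psharp H phi) I gamma.

Definition solves_inclusion (F : M -> set 'rV[R]_n) (I : interval R)
    (gamma : R -> M) : Prop :=
  locally_AC I gamma /\
  {ae lebesgue_measure, forall t : R, t \in I ->
    exists2 v, F (gamma t) v & has_velocity gamma t v}.

Definition solves_ode (F : M -> 'rV[R]_n) (I : interval R)
    (gamma : R -> M) : Prop :=
  locally_AC I gamma /\
  {ae lebesgue_measure, forall t : R, t \in I ->
    has_velocity gamma t (F (gamma t))}.

End Riemannian.

(* Main.v *)
(* If gamma has velocity v at an interior time t and q is in D^+phi(gamma t),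
   then a C^1 function touching phi from above at gamma t gives a function of
   time touching f := phi o gamma from above at t with slope <q, v>. If <q, v>
   took two values on D^+phi(gamma t), then f would have a concave corner at t,
   and an arbitrary function has only countably many corners; so <q, v> is
   independent of q for almost every t, and no Lipschitz estimate for phi is
   needed. If v = H_p(x, q0) with q0 in D^+phi(x), convexity gives
   H(x, q) >= H(x, q0) + <q - q0, v> = H(x, q0), so q0 is the minimizer. For a
   maximal slope curve, f' = L(gamma, v) + H(gamma, p) almost everywhere while
   f' = <q, v> for every q, so p realizes the supremum defining L(gamma, v) and
   again minimizes H over D^+phi. That velocities exist almost everywhere is
   Lebesgue's theorem for absolutely continuous curves, obtained here from the
   total variation, Lebesgue-Stieltjes measures and Radon-Nikodym. *)
From HB Require Import structures.
Require Import Defs.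
From mathcomp Require Import measurable_realfun.
From mathcomp Require Import ring lra.

Set Implicit Arguments.
Unset Strict Implicit.
Unset Printing Implicit Defensive.

Local Open Scope classical_set_scope.
Local Open Scope ring_scope.

(** * Almost everywhere on the real line *)

Section LebesgueAE.
Context {R : realType}.
Local Notation mu := (@lebesgue_measure R).
Implicit Types P Q : R -> Prop.

Lemma ae_imp P Q : {ae mu, forall x, P x} -> (forall x, P x -> Q x) ->
  {ae mu, forall x, Q x}.
Proof.
move=> aeP PQ; move: aeP; apply: filterS; last exact: PQ.
exact: (ae_filter_ringOfSetsType mu).
Qed.

Lemma ae_and P Q : {ae mu, forall x, P x} -> {ae mu, forall x, Q x} ->
  {ae mu, forall x, P x /\ Q x}.
Proof.
move=> aeP aeQ; move: aeP aeQ; apply: filterS2; last by split.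
exact: (ae_filter_ringOfSetsType mu).
Qed.

Lemma ae_forall_countable (T : countType) (P : T -> R -> Prop) :
  (forall i, {ae mu, forall x, P i x}) -> {ae mu, forall x, forall i, P i x}.
Proof.
move=> aeP.
have /ae_imp : {ae mu, forall x, forall n : nat,
    if unpickle n is Some i then P i x else True}.
  apply: ae_foralln => n; case: (unpickle n) => [i|]; first exact: aeP.
  exact: aeW.
by apply=> x Px i; have := Px (pickle i); rewrite pickleK.
Qed.

Lemma countable_ae (A : set R) : countable A -> {ae mu, forall x, ~ A x}.
Proof.
move=> cA; exists A; split; first exact: countable_measurable.
  exact: countable_lebesgue_measure0.
by move=> x /contrapT.
Qed.

Lemma ae_neq (a : R) : {ae mu, forall x : R, x != a}.
Proof. by apply: ae_imp (countable_ae (countable1 a)) _ => x /eqP. Qed.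

End LebesgueAE.

(** * Absolutely continuous functions are differentiable almost everywhere *)

Section AbsolutelyContinuous.
Context {R : realType}.
Implicit Types (a b x y e : R) (f : R -> R) (s : seq (R * R)).

Let nonoverlapping a b s :=
  all (fun u => [&& a <= u.1, u.1 <= u.2 & u.2 <= b]) s &&
  pairwise (fun u w => u.2 <= w.1) s.

Let len s : R := \sum_(u <- s) (u.2 - u.1).
Let var f s : R := \sum_(u <- s) `|f u.2 - f u.1|.

(** Consecutive points of a partition, taken in pairs, form a family of the kind that
    [absolutely_continuous] quantifies over. This links that definition with [total_variation]. *)
Lemma nonoverlapping_partition a b f l : itv_partition a b l ->
  exists s, [/\ nonoverlapping a b s, len s = b - a & var f s = variation a b f l].
Proof.
move=> abl; rewrite variation_zip//.
elim: l a abl => [|x l IH] a abl.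
  exists [::]; rewrite /len /var !big_nil; split => //.
  by move/itv_partition_nil: abl => ->; rewrite subrr.
have [+ _] := abl => /=/andP[ax _].
have xbl := itv_partition_cons abl.
have [s [/andP[sall spw] slen svar]] := IH _ xbl.
have xb := itv_partition_le xbl.
exists ((a, x) :: s); split.
- rewrite /nonoverlapping/= lexx ltW//= xb/=; apply/and3P; split => //.
  + apply/allP => u /(allP sall)/and3P[xu uu ub]; apply/and3P; split => //.
    by apply: le_trans xu; exact: ltW.
  + by apply/allP => u /(allP sall)/and3P[].
- by rewrite /len big_cons -/(len s) slen /=; ring.
- by rewrite /var !big_cons /= -svar.
Qed.

Lemma total_variation_refine x y f e : x <= y -> total_variation x y f \is a fin_num ->
  0 < e -> exists s, [/\ nonoverlapping x y s, len s = y - x &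
    fine (total_variation x y f) <= var f s + e].
Proof.
rewrite le_eqVlt => /predU1P[<- _ e0|xy TVfin e0].
  exists [::]; rewrite /len /var !big_nil subrr total_variationxx/= add0r.
  by split=> //; exact: ltW.
have [r [_ [l xyl <-] <-]] := ub_ereal_sup_adherent e0 TVfin.
have [s [sno slen <-]] := @nonoverlapping_partition _ _ f _ xyl.
rewrite -/(total_variation x y f) -(fineK TVfin) -EFinB lte_fin => Hs.
by exists s; split => //; lra.
Qed.

(** Each interval of [s] is cut by a partition that almost attains its total variation. The cuts
    keep the total length, so the [d] of absolute continuity that suits [s] also suits [s']. *)
Lemma total_variation_refine_seq a b f s e :
  (forall x y, a <= x -> x <= y -> y <= b -> total_variation x y f \is a fin_num) ->
  nonoverlapping a b s -> 0 < e ->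
  exists s', [/\ nonoverlapping a b s', len s' = len s &
    \sum_(u <- s) fine (total_variation u.1 u.2 f) <= var f s' + e].
Proof.
elim: s a e => [|u s IH] a e fin sno e0.
  by exists [::]; rewrite /var !big_nil add0r; split => //; exact: ltW.
move: sno => /andP[/= /andP[/and3P[au uu ub] sall] /andP[us spw]].
(* Half of the error goes to the first interval and half to the tail, so the length of [s] does not
   matter. The tail lies in [[u.2], [b]], which keeps the concatenation ordered. *)
have e20 : 0 < e / 2 by rewrite divr_gt0.
have [||s' [/andP[s'all s'pw] s'len s'var]] := IH u.2 _ _ _ e20.
- by move=> x y ux; apply: fin; rewrite (le_trans au)// (le_trans uu).
- apply/andP; split => //; apply/allP => w ws.
  by have /and3P[_ -> ->] := allP sall _ ws; rewrite (allP us _ ws).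
have [|t [/andP[tall tpw] tlen tvar]] := total_variation_refine (f := f) uu _ e20.
  exact: fin.
exists (t ++ s'); split.
- apply/andP; split.
    rewrite all_cat; apply/andP; split.
      apply/allP => w /(allP tall)/and3P[uw ww wu].
      by rewrite (le_trans au uw) ww (le_trans wu).
    apply/allP => w /(allP s'all)/and3P[uw ww wu].
    by rewrite (le_trans au (le_trans uu uw)) ww.
  rewrite pairwise_cat tpw s'pw !andbT; apply/allrelP => w z wt zs'.
  have /and3P[_ _ wu] := allP tall _ wt.
  by have /and3P[uz _ _] := allP s'all _ zs'; apply: le_trans uz.
- by rewrite /len big_cat -/(len t) -/(len s') /= tlen s'len /len big_cons.
- rewrite big_cons /var big_cat -/(var f t) -/(var f s') /=; lra.
Qed.

(** With [d] the response to 1, the variation on an interval shorter than [d] is at most 1, and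
    [[x], [y]] is a union of finitely many such intervals. *)
Lemma absolutely_continuous_bounded_variation a b f x y :
  absolutely_continuous a b f -> a <= x -> x <= y -> y <= b ->
  total_variation x y f \is a fin_num.
Proof.
move=> ACf ax xy yb; have [d d0 Hd] := ACf 1 ltr01.
have small u v : a <= u -> u <= v -> v <= b -> v - u < d ->
    total_variation u v f \is a fin_num.
  move=> au uv vb uvd.
  rewrite ge0_fin_numE ?total_variation_ge0//.
  apply: (@le_lt_trans _ _ 1%:E); last exact: ltry.
  apply: ge_ereal_sup => _ [_ [l uvl <-] <-]; rewrite lee_fin.
  have [s [/andP[sall spw] slen <-]] := @nonoverlapping_partition _ _ f _ uvl.
  apply/ltW/Hd => //; last by rewrite -/(len s) slen.
  apply/allP => w /(allP sall)/and3P[uw ww wv].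
  by rewrite (le_trans au uw) ww (le_trans wv vb).
(* Induction on the number of steps of length [d / 2]; the half keeps each step strictly shorter
   than [d]. *)
suff H n : forall z, x <= z -> z <= b -> z - x < n%:R * (d / 2) ->
    total_variation x z f \is a fin_num.
  apply: (H (Num.bound ((y - x) / (d / 2)))) => //.
  rewrite -ltr_pdivrMr ?divr_gt0//.
  by apply: le_lt_trans (archi_boundP _) => //; rewrite divr_ge0 ?subr_ge0// divr_ge0 ?ltW.
elim: n => [z xz zb|n IH z xz zb]; first by rewrite mul0r subr_lt0 ltNge xz.
rewrite -natr1 mulrDl mul1r => zn.
have [zx|xzd] := ltP (z - x) d; first exact: small.
have z'x : x <= z - d / 2 by lra.
rewrite (total_variationD _ z'x); last by lra.
by rewrite fin_numD IH ?small//; lra.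
Qed.

(** The increment of the variation function over an interval is the total variation there. A
    refinement of the same total length approximates the sum of these up to [e / 2], and absolute
    continuity of [f] bounds the refined sum by [e / 2]. *)
Lemma absolutely_continuous_total_variation a b f :
  absolutely_continuous a b f ->
  absolutely_continuous a b (fine \o total_variation a ^~ f : R -> R).
Proof.
move=> ACf e e0; have e20 : 0 < e / 2 by rewrite divr_gt0.
have [d d0 Hd] := ACf _ e20; exists d => // s sall spw slen.
have fin x y := @absolutely_continuous_bounded_variation a b f x y ACf.
have [|s' [/andP[s'all s'pw] s'len s'var]] :=
  @total_variation_refine_seq a b f s _ fin _ e20; first exact/andP.
have : var f s' < e / 2 by apply: Hd => //; rewrite -/(len s') s'len.
move=> varlt.
rewrite (@eq_big_seq _ _ _ _ _ _ (fun u => fine (total_variation u.1 u.2 f))).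
  lra.
move=> u /(allP sall)/and3P[au uu ub] /=.
rewrite (total_variationD f au uu) fineD ?fin//; last exact: le_trans ub.
by rewrite addrAC subrr add0r ger0_norm// fine_ge0// total_variation_ge0.
Qed.

Lemma absolutely_continuousB a b f g :
  absolutely_continuous a b f -> absolutely_continuous a b g ->
  absolutely_continuous a b (f \- g).
Proof.
move=> ACf ACg e e0; have e20 : 0 < e / 2 by rewrite divr_gt0.
have [df df0 Hf] := ACf _ e20; have [dg dg0 Hg] := ACg _ e20.
exists (Num.min df dg); first by rewrite lt_min df0.
move=> s sall spw; rewrite lt_min => /andP[sf sg].
have := Hf s sall spw sf; have := Hg s sall spw sg.
suff : \sum_(u <- s) `|(f \- g) u.2 - (f \- g) u.1| <=
  \sum_(u <- s) `|f u.2 - f u.1| + \sum_(u <- s) `|g u.2 - g u.1| by lra.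
rewrite -big_split/=; apply: ler_sum => u _ /=.
rewrite (_ : _ - _ = (f u.2 - f u.1) - (g u.2 - g u.1)); last by ring.
exact: ler_normB.
Qed.

End AbsolutelyContinuous.

(** * Countable families of disjoint intervals and components of open sets *)

Section NondecreasingAC.
Context {R : realType}.
Implicit Types (a b x y e d : R) (G : R -> R).
Local Notation mu := (@lebesgue_measure R).

(** Precomposition with [clamp a b] extends a function from [[a], [b]] to the line by constants;
    this is how [G] becomes a cumulative function below. *)
Definition clamp a b x : R := Num.max a (Num.min b x).

Lemma clamp_in a b x : a <= b -> a <= clamp a b x <= b.
Proof. by move=> ab; rewrite /clamp le_max lexx ge_max ab ge_min lexx. Qed.

Lemma clamp_id a b x : a <= x <= b -> clamp a b x = x.
Proof. by move=> /andP[ax xb]; rewrite /clamp min_r// max_r. Qed.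

Lemma le_clamp a b x y : x <= y -> clamp a b x <= clamp a b y.
Proof. by move=> xy; apply: le_max2 => //; apply: le_min2. Qed.

Lemma clamp_sub a b x y : x <= y -> clamp a b y - clamp a b x <= y - x.
Proof.
move=> xy; rewrite /clamp.
have [bx|bx] := leP b x; have [b_y|b_y] := leP b y; try lra.
- have [? |?] := leP a b; have [? |?] := leP a x; lra.
- have [? |?] := leP a x; have [? |?] := leP a y; lra.
Qed.

(** Disjoint intervals listed in arbitrary order, possibly degenerate or leaving [[a], [b]], are
    brought into the form required by absolute continuity: the degenerate ones are dropped, the rest
    sorted by left endpoint and clamped. *)
Lemma absolutely_continuous_disjoint a b G e d (u : nat -> R * R) m : a <= b ->
  (forall s : seq (R * R),
      all (fun u => [&& a <= u.1, u.1 <= u.2 & u.2 <= b]) s ->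
      pairwise (fun u w => u.2 <= w.1) s ->
      \sum_(u <- s) (u.2 - u.1) < d ->
      \sum_(u <- s) `|G u.2 - G u.1| < e) ->
  (forall k, (u k).1 <= (u k).2) ->
  trivIset setT (fun k => `](u k).1, (u k).2[%classic) ->
  \sum_(0 <= k < m) ((u k).2 - (u k).1) < d ->
  \sum_(0 <= k < m) `|G (clamp a b (u k).2) - G (clamp a b (u k).1)| < e.
Proof.
move=> ab ACG uu tu.
pose nd (w : R * R) := w.1 < w.2; pose leT (w z : R * R) := w.1 <= z.1.
pose l := [seq u k | k <- index_iota 0 m & nd (u k)].
(* The midpoint between the larger left endpoint and the smaller right endpoint lies in both
   intervals. *)
have overlap j k : nd (u j) -> nd (u k) ->
    (u j).1 < (u k).2 -> (u k).1 < (u j).2 -> j = k.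
  move=> ndj ndk jk kj; apply: tu => //.
  exists ((Num.max (u j).1 (u k).1 + Num.min (u j).2 (u k).2) / 2).
  have H1 : (u j).1 < (u j).2 := ndj; have H2 : (u k).1 < (u k).2 := ndk.
  rewrite /= !in_itv/=.
  have [?|?] := leP (u j).1 (u k).1; have [?|?] := leP (u j).2 (u k).2;
    split; apply/andP; split; lra.
have ul : uniq l.
  rewrite map_inj_in_uniq ?filter_uniq ?iota_uniq// => j k.
  rewrite !mem_filter => /andP[ndj _] /andP[ndk _] ujk.
  by apply: overlap => //; rewrite ?ujk//; rewrite -ujk.
have leTtr : transitive leT by move=> ? ? ?; exact: le_trans.
have leTtot : total leT by move=> ? ?; exact: le_total.
have pw : pairwise (fun w z : R * R => w.2 <= z.1) (sort leT l).
  have := sort_sorted leTtot l; rewrite (sorted_pairwise leTtr) => lpw.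
  have := ul; rewrite -(sort_uniq leT) uniq_pairwise => upw.
  (* Sorting orders only the left endpoints. For two distinct members, disjointness then places the
     right endpoint of the earlier one before the left endpoint of the later one. *)
  have : pairwise [rel x y | leT x y && (x != y)] (sort leT l).
    by rewrite pairwise_relI lpw.
  apply: (@sub_in_pairwise _ (mem l)); last by apply/allP => x; rewrite mem_sort.
  move=> _ _ /mapP[j + ->] /mapP[k + ->] /=.
  rewrite !mem_filter => /andP[ndj _] /andP[ndk _] /andP[].
  rewrite /leT => jk; apply: contra_neqT; rewrite -ltNge => kj.
  congr u; apply: overlap => //; exact: le_lt_trans ndk.
(* Both sums of the statement give degenerate intervals the value 0, so neither changes under
   filtering and sorting. *)
have sumE (F : R * R -> R) : (forall k, (u k).1 = (u k).2 -> F (u k) = 0) ->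
    \sum_(0 <= k < m) F (u k) = \sum_(w <- sort leT l) F w.
  move=> F0; rewrite (perm_big l) ?perm_sort//= big_map big_filter [RHS]big_mkcond/=.
  apply: eq_bigr => k _; rewrite /nd.
  by case: ltP => // ku; apply: F0; apply/le_anti; rewrite uu ku.
rewrite (sumE (fun w => w.2 - w.1)); last by move=> k ->; rewrite subrr.
rewrite (sumE (fun w => `|G (clamp a b w.2) - G (clamp a b w.1)|)); last first.
  by move=> k ->; rewrite subrr normr0.
have allnd w : w \in sort leT l -> w.1 <= w.2.
  by rewrite mem_sort => /mapP[k _ ->].
move=> lend.
rewrite -(big_map (fun w => (clamp a b w.1, clamp a b w.2)) xpredT
  (fun w => `|G w.2 - G w.1|)).
apply: ACG.
- apply/allP => _ /mapP[w /allnd ww ->] /=.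
  have /andP[-> _] := clamp_in w.1 ab; have /andP[_ ->] := clamp_in w.2 ab.
  by rewrite le_clamp.
- rewrite pairwise_map; apply: sub_pairwise pw => w z /=; exact: le_clamp.
- rewrite big_map; apply: le_lt_trans lend.
  rewrite big_seq [leRHS]big_seq; apply: ler_sum => w /allnd ww; exact: clamp_sub.
Qed.

(** Recovers endpoints for a component of an open set. The half-open superset is the shape on which
    a Lebesgue-Stieltjes measure has an explicit value. *)
Lemma open_interval_endpoints (A : set R) : open A -> is_interval A ->
  (mu A < +oo)%E -> exists u : R * R, [/\ u.1 <= u.2,
    `]u.1, u.2[ `<=` A, A `<=` `]u.1, u.2] & mu A = (u.2 - u.1)%:E].
Proof.
have [->|/set0P[x0 Ax0]] := eqVneq A set0.
  move=> _ _ _; exists (0, 0); rewrite measure0 subrr/=; split => //.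
  by rewrite set_itvE.
move=> oA iA Afin.
have AE : A = [set` Rhull A] by exact/is_intervalP.
have := Afin; rewrite {1}AE lebesgue_measure_itv.
move: (Rhull A) AE => [i j] AE /=.
have ij : (i < j)%O.
  rewrite ltNge; apply/negP => ji; move: Ax0; rewrite AE.
  by rewrite set_itv_ge// -leNgt.
(* Finite measure excludes infinite endpoints, so only two finite bounds remain. *)
case: i j AE ij => [x c|[]] [y d|[]] AE ij //=; rewrite ?ltNyr ?ltry ?ltNyy //=.
  move=> _.
  have cd : c <= d by move: ij; case: (x) (y) => [] []; rewrite bnd_simp => // /ltW.
  exists (c, d) => /=; split => //.
  - rewrite AE => z /=; rewrite !in_itv /= => /andP[cz zd].
    by apply/andP; split; [case: (x)|case: (y)] => //=; exact: ltW.
  - move=> z Az.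
    have : z \in Interval (BSide x c) (BSide y d) by move: Az; rewrite AE.
    rewrite /= !in_itv/= => /andP[cz zd].
    have zd' : z <= d by move: zd; case: (y) => //= /ltW.
    rewrite zd' andbT lt_neqAle; have cz' : c <= z by case: (x) cz => //= /ltW.
    rewrite cz' andbT; apply/eqP => zc.
    (* If the left endpoint belonged to [A], openness would put points to its left in [A]. *)
    have /(@nbhs_ballP _ R) [e /= e0 He] : nbhs z A by exact: open_nbhs_nbhs.
    have : A (z - e / 2).
      apply: He; rewrite /ball/= opprB addrC subrK gtr0_norm ?divr_gt0//.
      by rewrite ltr_pdivrMr// ltr_pMr// ltr1n.
    rewrite AE /= in_itv/= => /andP[+ _].
    have : z - e / 2 < c by rewrite -zc ltrBlDr ltrDl divr_gt0.
    by move=> lt; case: (x) => /=; [rewrite leNgt lt|move=> /ltW; rewrite leNgt lt].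
  - rewrite AE lebesgue_measure_itv /= lte_fin; case: ltP => // dc.
    by have -> : d = c by [apply/le_anti; rewrite cd dc]; rewrite subrr.
Qed.

End NondecreasingAC.

(** * Lebesgue-Stieltjes measures and derivatives of monotone functions *)

Section Derivability.
Context {R : realType}.
Implicit Types (a b x y e d : R) (G : R -> R).
Local Notation mu := (@lebesgue_measure R).

Lemma lebesgue_stieltjes_measure_itvoc (f : cumulative R R) x y : x <= y ->
  lebesgue_stieltjes_measure f `]x, y] = (f y - f x)%:E.
Proof.
move=> xy; rewrite /lebesgue_stieltjes_measure /measure_extension.
by rewrite measurable_mu_extE/= ?wlength_itv_bnd//; exact: is_ocitv.
Qed.

Lemma subset_le_measure (m : {measure set (measurableTypeR R) -> \bar R})
    (A B : set R) :
  measurable A -> measurable B -> A `<=` B -> (m A <= m B)%E.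
Proof.
move=> mA mB AB; have := @le_measure _ _ _ m A B; apply => //; rewrite inE.
  exact: mA.
exact: mB.
Qed.

Lemma absolutely_continuous_clamp_continuous a b G : a <= b ->
  absolutely_continuous a b G -> continuous (G \o clamp a b : R -> R).
Proof.
move=> ab ACG x; apply/(@cvgrPdist_lt _ R^o) => e e0.
have [d d0 Hd] := ACG e e0.
have main y z : y <= z -> z - y < d ->
    `|G (clamp a b z) - G (clamp a b y)| < e.
  move=> yz yzd; have := Hd [:: (clamp a b y, clamp a b z)].
  rewrite !big_seq1/=; apply => //.
    have /andP[-> _] := clamp_in y ab; have /andP[_ ->] := clamp_in z ab.
    by rewrite le_clamp.
  exact: le_lt_trans (clamp_sub _ _ yz) yzd.
near=> z; have zx : `|x - z| < d.
  by near: z; apply: (@cvgr_dist_lt _ R^o) => //; exact: cvg_id.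
rewrite /=; have [xz|/ltW xz] := leP x z.
  rewrite distrC; apply: main => //.
  by rewrite distrC ger0_norm ?subr_ge0 in zx.
by apply: main => //; rewrite ger0_norm ?subr_ge0 in zx.
Unshelve. all: by end_near. Qed.

(** Outer regularity encloses [N] in an open set of Lebesgue measure below [d]. The increments of
    [f] over its components bound the Stieltjes measure of that set, and absolute continuity keeps
    their sum below [e]. *)
Lemma stieltjes_null a b G (f : cumulative R R) (N : set R) : a <= b ->
  absolutely_continuous a b G -> f =1 G \o clamp a b ->
  measurable N -> mu N = 0%E -> lebesgue_stieltjes_measure f N = 0%E.
Proof.
move=> ab ACG fE mN N0.
set nu := lebesgue_stieltjes_measure f.
apply/eqP; rewrite eq_le measure_ge0 andbT.
apply/lee_addgt0Pr => e e0; rewrite add0e.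
have [d d0 Hd] := ACG e e0.
have Nfin : (mu N < +oo)%E by rewrite N0 ltry.
have [U [oU NU Ud]] := lebesgue_regularity_outer mN Nfin d0.
have mU : measurable U by exact: open_measurable.
have {}Ud : (mu U < d%:E)%E.
  rewrite -(setDUK NU).
  apply: (@le_lt_trans _ _ (mu N + mu (U `\` N))%E); last by rewrite N0 add0e.
  by apply: measureU2 => //; exact: measurableD.
pose I := open_disjoint_itv oU.
have tI : trivIset setT I by exact: open_disjoint_itv_trivIset.
have oI k : open (I k) by exact: open_disjoint_itv_open.
have mI k : measurable (I k) by exact: open_measurable.
have UI : U = \bigcup_k I k by exact: open_disjoint_itv_bigcup.
have IU k : I k `<=` U by rewrite [X in _ `<=` X]UI; exact: bigcup_sup.
have muU (m : {measure set (measurableTypeR R) -> \bar R}) :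
    m U = (\sum_(0 <= k <oo) m (I k))%E.
  rewrite {1}UI; apply: (@measure_semi_bigcup _ _ (measurableTypeR R) m) => //.
  by rewrite -UI; exact: mU.
have Ifin k : (mu (I k) < +oo)%E.
  apply: (@le_lt_trans _ _ (mu U)); last exact: lt_trans Ud (ltry _).
  exact: (subset_le_measure mu (mI k) mU (IU k)).
have /choice[u Hu] k := open_interval_endpoints (oI k)
  (@open_disjoint_itv_is_interval _ _ oU k) (Ifin k).
have nuI k : (nu (I k) <= (f (u k).2 - f (u k).1)%:E)%E.
  have [uu _ Iu _] := Hu k.
  rewrite -lebesgue_stieltjes_measure_itvoc//.
  exact: (subset_le_measure nu (mI k) (measurable_itv _) Iu).
apply: (@le_trans _ _ (nu U)); first exact: (subset_le_measure nu mN mU NU).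
rewrite [leLHS](muU nu).
apply: lime_le; first by apply: is_cvg_nneseries => *; exact: measure_ge0.
(* It is enough to bound every finite partial sum by [e], since absolute continuity speaks of finite
   families. *)
near=> m.
apply: (@le_trans _ _ (\sum_(0 <= k < m) `|G (clamp a b (u k).2) - G (clamp a b (u k).1)|)%:E).
  rewrite -sumEFin; apply: lee_sum => k _; apply: le_trans (nuI k) _.
  by rewrite lee_fin !fE; exact: ler_norm.
rewrite lee_fin; apply/ltW/(absolutely_continuous_disjoint ab Hd).
- by move=> k; have [] := Hu k.
- move=> i j _ _ [z [iz jz]]; apply: tI => //; exists z.
  have [_ ui _ _] := Hu i; have [_ uj _ _] := Hu j.
  by split; [exact: ui|exact: uj].
- rewrite -lte_fin; apply: le_lt_trans Ud.
  rewrite (muU mu) -sumEFin.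
  rewrite [leLHS](_ : _ = \sum_(0 <= k < m) mu (I k))%E.
    by apply: nneseries_lim_ge => *; exact: measure_ge0.
  by apply: eq_bigr => k _; have [_ _ _ ->] := Hu k.
Unshelve. all: by end_near. Qed.

(** The Stieltjes measure of [G] on ][a], [b]] has a Radon-Nikodym density, so [G] is an indefinite
    integral there, and such integrals are differentiable almost everywhere. *)
Lemma nondecreasing_absolutely_continuous_derivable a b G : a < b ->
  {in `[a, b] &, nondecreasing_fun G} -> absolutely_continuous a b G ->
  {ae mu, forall x, a < x < b -> derivable G x 1}.
Proof.
move=> ab ndG ACG; have aleb := ltW ab.
pose G' : R -> R := G \o clamp a b.
have ndG' : nondecreasing G'.
  by move=> x y xy; apply: ndG; rewrite ?in_itv/= ?clamp_in//; exact: le_clamp.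
have cG' : right_continuous G'.
  by apply: right_continuousW; exact: absolutely_continuous_clamp_continuous.
pose f : cumulative R R := HB.pack G' (isCumulative.Build R _ R G' ndG' cG').
pose D : set (measurableTypeR R) := `]a, b]%classic.
have mD : measurable D by exact: measurable_itv.
have Dfin : (lebesgue_stieltjes_measure f D < +oo)%E.
  by rewrite lebesgue_stieltjes_measure_itvoc// ltry.
(* Restricting to ][a], [b]] gives a finite measure, to which Radon-Nikodym applies and whose
   density is integrable on the whole line. *)
have dom : mfrestr mD Dfin `<< mu.
  apply/null_content_dominatesP => N mN N0; rewrite /mfrestr /mrestr.
  apply: (@stieltjes_null a b G) => //; first exact: measurableI.
  by apply/eqP; rewrite -measure_le0 -N0 le_measure ?inE//; exact: measurableI.
have [g [g0 gfin intg gE]] := radon_nikodym_sigma_finite dom.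
have fg : EFin \o (fine \o g) = g by apply/funext => x /=; rewrite fineK.
have intg' : mu.-integrable setT (EFin \o (fine \o g)) by rewrite fg.
have loc : locally_integrable setT (fine \o g) by exact: open_integrable_locally openT _.
have intgS y : mu.-integrable `]a, y] (EFin \o (fine \o g)).
  by apply: integrableS intg' => //; exact: measurable_itv.
have := @FTC1 R (fine \o g) (BRight a) intgS loc.
apply: filterS; first exact: (ae_filter_ringOfSetsType mu).
move=> x /= + /andP[ax xb] => /(_ ax)[dF _].
set F := (F in derivable F _ _) in dF.
have FG y : a < y < b -> G y = G a + F y.
  move=> /andP[ay yb].
  have DE : `]a, y]%classic `&` D = `]a, y]%classic :> set (measurableTypeR R).
    apply/seteqP; split => z /=; rewrite !in_itv/=; first by case.
    move=> /andP[az zy]; split => //; rewrite /D/= ?in_itv/= ?az ?zy//.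
    by rewrite (le_trans zy (ltW yb)).
  have : lebesgue_stieltjes_measure f (`]a, y]%classic `&` D) =
    (\int[mu]_(x in `]a, y]) g x)%E by exact: gE (measurable_itv _).
  rewrite DE -fg.
  rewrite lebesgue_stieltjes_measure_itvoc ?ltW// /f /= /G' /= !clamp_id ?lexx ?ltW//.
  by rewrite /F /Rintegral => <- /=; rewrite addrC subrK.
apply: (@near_eq_derivable _ _ _ (fun y => G a + F y)) => //.
  near=> y; rewrite /= [RHS]FG//.
  have : y \in `]a, b[ by near: y; apply: near_in_itvoo; rewrite in_itv/= ax.
  by rewrite in_itv.
exact: derivableD.
Unshelve. all: by end_near. Qed.

End Derivability.

(** * Derivatives of absolutely continuous functions by Jordan decomposition *)

Section AEDerivability.
Context {R : realType}.
Implicit Types (a b x y : R).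
Local Notation mu := (@lebesgue_measure R).

(** Jordan decomposition: with [V] the variation function, [f] is the difference of [V] and [V - f],
    both nondecreasing and absolutely continuous. *)
Lemma absolutely_continuous_derivable a b (f : R -> R) : a < b ->
  absolutely_continuous a b f ->
  {ae mu, forall x, a < x < b -> derivable f x 1}.
Proof.
move=> ab ACf.
pose V : R -> R := fine \o total_variation a ^~ f.
have ACV : absolutely_continuous a b V.
  exact: absolutely_continuous_total_variation.
have VD x y : a <= x -> x <= y -> y <= b -> `|f y - f x| <= V y - V x.
  move=> ax xy yb.
  have fin u v := @absolutely_continuous_bounded_variation R a b f u v ACf.
  rewrite /V /= (total_variationD f ax xy) fineD ?fin//; last exact: le_trans yb.
  by rewrite addrAC subrr add0r -lee_fin fineK ?total_variation_ge// fin.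
have ndV : {in `[a, b] &, nondecreasing_fun V}.
  move=> x y; rewrite !in_itv/= => /andP[ax _] /andP[_ yb] xy.
  by rewrite -subr_ge0 (le_trans _ (VD _ _ ax xy yb)).
have ndVf : {in `[a, b] &, nondecreasing_fun (V \- f)}.
  move=> x y; rewrite !in_itv/= => /andP[ax _] /andP[_ yb] xy.
  by have := VD _ _ ax xy yb; have := ler_norm (f y - f x); lra.
have ACVf := absolutely_continuousB ACV ACf.
have := nondecreasing_absolutely_continuous_derivable ab ndVf ACVf.
have := nondecreasing_absolutely_continuous_derivable ab ndV ACV.
apply: filterS2; first exact: (ae_filter_ringOfSetsType mu).
move=> x + + axb => /(_ axb) dV /(_ axb) dVf.
rewrite (_ : f = V - (V \- f)); first exact: derivableB.
by apply/funext => z; rewrite !fctE /=; ring.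
Qed.

Lemma entry_le_norm m n (A : 'M[R]_(m, n)) i j : `|A i j| <= `|A|.
Proof.
rewrite [leRHS]mx_normrE.
exact: (le_bigmax _ (fun k => `|A k.1 k.2|) (i, j)).
Qed.

Lemma absolutely_continuous_row_derivable n a b (f : R -> 'rV[R]_n) : a < b ->
  absolutely_continuous a b f ->
  {ae mu, forall x, a < x < b -> derivable f x 1}.
Proof.
move=> ab ACf.
have main (j : 'I_n) : {ae mu, forall x, a < x < b -> derivable (fun t => f t 0 j) x 1}.
  apply: absolutely_continuous_derivable => // e e0.
  have [d d0 Hd] := ACf e e0; exists d => // s sall spw slen.
  apply: le_lt_trans (Hd s sall spw slen); apply: ler_sum => u _.
  by have := entry_le_norm (f u.2 - f u.1) 0 j; rewrite !mxE.
have Hall : {ae mu, forall x, forall j : 'I_n, a < x < b ->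
    derivable (fun t => f t 0 j) x 1}.
  by apply: filter_forall main; exact: (ae_filter_ringOfSetsType mu).
move: Hall.
apply: filterS; first exact: (ae_filter_ringOfSetsType mu).
move=> x Hx axb; apply/derivable_mxP => i j.
by rewrite (ord1 i); exact: Hx.
Qed.

End AEDerivability.

(** * Completed Lebesgue measure *)

Section CompletedLebesgue.
Context {R : realType}.
Local Notation mu := (@lebesgue_measure R).
Local Notation cmu := (@completed_lebesgue_measure R).
Local Notation cR := (caratheodory_type (wlength (@idfun R))^*%mu).
Local Notation bR := (measurableTypeR R).

Lemma borel_completed_measurable (A : set R) :
  measurable (A : set bR) -> measurable (A : set cR).
Proof. exact: sub_caratheodory. Qed.

(** A completed measurable set is a Borel set together with part of a Borel null set [N]. Equality
    off [N] keeps that arbitrary part out of later arguments. *)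
Lemma completed_measurable_decomposition (A : set R) : measurable (A : set cR) ->
  exists B N : set R, [/\ measurable (B : set bR), measurable (N : set bR),
    mu N = 0%E & A `\` N = B `\` N].
Proof.
move=> mA.
have : (completed_algebra_gen mu).-sigma.-measurable A.
  by rewrite completed_caratheodory_measurable.
rewrite g_sigma_completed_algebra_genE => -[B mB [M [N [mN N0 MN]] BM]].
exists B, N; split => //; rewrite -BM.
apply/seteqP; split => x /=; last by move=> [Bx Nx]; split => //; left.
by move=> [[Bx //|/MN]].
Qed.

(** The sets where [f] exceeds a rational are countably many and determine measurability; each is
    Borel off a null set, and the union of these null sets is null. *)
Lemma completed_measurable_fun_borel (f : R -> \bar R) (D : set R) :
  measurable (D : set bR) -> measurable_fun (D : set cR) f ->
  exists N : set R, [/\ measurable (N : set bR), mu N = 0%E &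
    measurable_fun (D `\` N : set bR) f].
Proof.
move=> mD mf.
(* Enumerates the rationals by natural numbers; a number coding no rational yields 0, a harmless
   repetition. *)
pose rat_of n : R := ratr (odflt (0 : rat) (unpickle n)).
have rat_ofE (q : rat) : rat_of (pickle q) = ratr q by rewrite /rat_of pickleK.
have mq n : measurable (D `&` f @^-1` `](rat_of n)%:E, +oo[ : set cR).
  by apply: mf; [exact: borel_completed_measurable|exact: emeasurable_itv].
have /choice[BN HBN] n : exists BN : set R * set R, [/\ measurable (BN.1 : set bR),
    measurable (BN.2 : set bR), mu BN.2 = 0%E &
    (D `&` f @^-1` `](rat_of n)%:E, +oo[) `\` BN.2 = BN.1 `\` BN.2].
  by have [B [N ?]] := completed_measurable_decomposition (mq n); exists (B, N).
pose N := \bigcup_n (BN n).2.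
have mN : measurable (N : set bR).
  by apply: bigcupT_measurable => n; have [] := HBN n.
exists N; split => //.
  apply: measure_negligible => //; apply: negligible_bigcup => n.
  by have [_ mBN BN0 _] := HBN n; exact/negligibleP.
move=> mDN; apply: (measurability _ (ErealGenOInfty.measurableE R)) => // _ [_ [r ->] <-].
(* [f] exceeds [r] exactly where it exceeds some rational above [r], and off [N] that set is one of
   the chosen Borel sets. *)
rewrite (_ : _ `&` _ = \bigcup_n (if r < rat_of n then (BN n).1 `\` N else set0)).
  apply: bigcupT_measurable => n; case: ifP => // _.
  by apply: measurableD => //; have [] := HBN n.
apply/seteqP; split => z /=.
- move=> [[Dz Nz]]; rewrite in_itv/= andbT => rz.
  have [q rq qz] : exists2 q : rat, r < ratr q & ((ratr q)%:E < f z)%E.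
    case: (f z) rz => [s| |//].
      rewrite lte_fin => /rat_in_itvoo[q]; rewrite in_itv/= => /andP[? ?].
      by exists q => //; rewrite lte_fin.
    move=> _; have [q] := rat_in_itvoo (ltr_pwDr ltr01 (lexx r)).
    by rewrite in_itv/= => /andP[? ?]; exists q => //; rewrite ltry.
  exists (pickle q) => //; rewrite rat_ofE rq; split => //.
  have [_ _ _ E] := HBN (pickle q).
  suff : ((BN (pickle q)).1 `\` (BN (pickle q)).2) z by case.
  rewrite -E rat_ofE; split; first by split => //=; rewrite in_itv/= qz.
  by move=> Nqz; apply: Nz; exists (pickle q).
- move=> [q _]; case: ifP => // rq [Bz Nz].
  have [_ _ _ E] := HBN q.
  have : ((BN q).1 `\` (BN q).2) z by split => // Nqz; apply: Nz; exists q.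
  rewrite -E => -[[Dz /=]]; rewrite !in_itv/= !andbT => qz _.
  by split => //; apply: lt_trans qz; rewrite lte_fin.
Qed.

(** The identity from the completed line to the Borel line is measurable and pushes the completed
    measure forward to Lebesgue measure; nonnegative functions are treated first, then positive and
    negative parts. *)
Lemma completed_integral_borel (g : R -> \bar R) (D : set R) :
  measurable (D : set bR) -> measurable_fun (D : set bR) g ->
  (\int[cmu]_(x in D) g x = \int[mu]_(x in D) g x)%E.
Proof.
move=> mD mg.
have mid : measurable_fun (setT : set cR) (idfun : cR -> bR).
  by move=> _ B mB; rewrite setTI; exact: borel_completed_measurable.
rewrite integralE [RHS]integralE.
have ge0 (h : R -> \bar R) : measurable_fun (D : set bR) h -> (forall x, (0 <= h x)%E) ->
    (\int[cmu]_(x in D) h x = \int[mu]_(x in D) h x)%E.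
  move=> mh h0.
  rewrite -(@eq_measure_integral _ bR _ D mu (pushforward cmu (idfun : cR -> bR))).
    by rewrite (ge0_integral_pushforward mid).
  by [].
by rewrite !ge0//; [exact: measurable_funeneg|exact: measurable_funepos].
Qed.

End CompletedLebesgue.

(** * Differentiation of integrals for the completed Lebesgue measure *)

Section CompletedDifferentiation.
Context {R : realType}.
Local Notation mu := (@lebesgue_measure R).
Local Notation cmu := (@completed_lebesgue_measure R).
Local Notation cR := (caratheodory_type (wlength (@idfun R))^*%mu).
Local Notation bR := (measurableTypeR R).
Implicit Types (f g : R -> \bar R) (a b x y : R).

Lemma completed_ae (P : set R) : {ae mu, forall x, P x} -> {ae cmu, forall x, P x}.
Proof.
move=> [N [mN N0 PN]]; exists N; split => //; exact: borel_completed_measurable.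
Qed.

(** Setting [f] to zero on a null set makes it Borel, and integrability makes it finite almost
    everywhere. The resulting real function is one to which [FTC1] applies. *)
Lemma completed_integrable_borel f a b : cmu.-integrable `[a, b] f ->
  exists g : R -> R, mu.-integrable (setT : set bR) (EFin \o g) /\
    {ae mu, forall x, a <= x <= b -> f x = (g x)%:E}.
Proof.
move=> intf; pose D := `[a, b]%classic : set R.
have mD : measurable (D : set bR) by exact: measurable_itv.
have /integrableP[mf foo] := intf.
have [N [mN N0 mfN]] := completed_measurable_fun_borel mD mf.
have aeN : {ae mu, forall x, ~ N x}.
  by exists N; split => // x /= /contrapT.
have mDN : measurable (D `\` N : set bR) by exact: measurableD.
pose h := f \_ (D `\` N).
have mh : measurable_fun (setT : set bR) h by have [+ _] := measurable_restrictT f mDN; exact.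
have inth : mu.-integrable (setT : set bR) h.
  apply/integrableP; split => //.
  apply: le_lt_trans foo.
  rewrite -completed_integral_borel; [|exact: measurableT|exact: measurableT_comp].
  rewrite (@eq_integral _ _ _ cmu _ ((abse \o f) \_ (D `\` N))); last first.
    by move=> x _; rewrite /h /= !patchE; case: ifP => //; rewrite abse0.
  rewrite -integral_mkcond; apply: ge0_subset_integral => //.
  - exact: borel_completed_measurable.
  - exact: borel_completed_measurable.
  - exact: measurableT_comp.
  - by move=> x _; exact: abse_ge0.
pose g : R -> R := fun x => fine (h x).
exists g.
have hfin := integrable_ae measurableT inth.
split.
- have mg : measurable_fun (setT : set bR) (EFin \o g).
    by apply/measurable_EFinP; apply: measurableT_comp.
  apply/integrableP; split => //.
  have /integrableP[_ hoo] := inth.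
  apply: le_lt_trans hoo; apply: ae_ge0_le_integral => //.
  + exact: measurableT_comp.
  + exact: measurableT_comp.
  + by apply: filterS hfin => x /= hx _; rewrite -[in leRHS](fineK (hx I)).
- apply: filterS2 hfin aeN => x /= hx Nx axb; rewrite /g /= fineK ?hx// /h patchE mem_set//.
Qed.

(** Completeness transfers measurability from [f] to [g]. Below, [g] involves [psharp], for which no
    measurability has been established. *)
Lemma completed_integrable_ae_eq f g a b : cmu.-integrable `[a, b] f ->
  {ae mu, forall x, a < x < b -> f x = g x} ->
  cmu.-integrable `[a, b] g /\
  (\int[cmu]_(x in `[a, b]) f x = \int[cmu]_(x in `[a, b]) g x)%E.
Proof.
move=> intf fg; have mD : measurable (`[a, b]%classic : set cR).
  by apply: borel_completed_measurable; exact: measurable_itv.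
have /integrableP[mf foo] := intf.
have aefg : ae_eq cmu (`[a, b]%classic : set cR) f g.
  apply: completed_ae; apply: ae_imp (ae_and fg (ae_and (ae_neq a) (ae_neq b))) _.
  move=> x [/= fgx [xa xb]]; rewrite in_itv/= !le_eqVlt eq_sym (negbTE xa) (negbTE xb).
  exact: fgx.
have mg := ae_measurable_fun (@completed_lebesgue_measure_is_complete R) aefg mf.
split; last exact: ae_eq_integral.
apply/integrableP; split => //; apply: le_lt_trans foo.
rewrite le_eqVlt; apply/orP; left; apply/eqP.
apply: (@ae_eq_integral _ _ _ cmu _ (abse \o f) (abse \o g)) => //.
- exact: measurableT_comp.
- exact: measurableT_comp.
- by apply/ae_eq_sym/ae_eq_abse.
Qed.

(** After [f] is replaced by a Borel representative, this is Lebesgue differentiation of an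
    indefinite integral, which equals [F] up to a constant near each interior point. *)
Lemma completed_integral_is_derive f (F : R -> R) a b : a < b ->
  cmu.-integrable `[a, b] f ->
  (forall y, a < y <= b ->
    (F y - F a)%:E = (\int[cmu]_(x in `[a, y]) f x)%E) ->
  {ae mu, forall x, a < x < b ->
    f x \is a fin_num /\ is_derive x (1 : R) F (fine (f x))}.
Proof.
move=> ab intf FE.
have [g [intg fg]] := completed_integrable_borel intf.
have loc : locally_integrable setT g by exact: open_integrable_locally openT _.
have intgS y : mu.-integrable `[a, y] (EFin \o g).
  by apply: integrableS intg => //; exact: measurable_itv.
have FG y : a < y <= b -> F y = F a + \int[mu]_(x in `[a, y]) g x.
  move=> /andP[ay yb]; have := FE y; rewrite ay yb => /(_ isT).
  have intfy : cmu.-integrable `[a, y] f.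
    apply: integrableS intf.
    - by apply: borel_completed_measurable; exact: measurable_itv.
    - by apply: borel_completed_measurable; exact: measurable_itv.
    - by apply: subset_itvl; rewrite bnd_simp.
  have [|_ ->] := @completed_integrable_ae_eq f (EFin \o g) a y intfy.
    apply: ae_imp fg _ => x /= Hx /andP[ax xy]; apply: Hx; rewrite ltW//=.
    by rewrite ltW// (lt_le_trans xy).
  rewrite completed_integral_borel; last 2 first.
  - exact: measurable_itv.
  - by have /integrableP[] := intgS y.
  by rewrite /Rintegral => <- /=; rewrite addrC subrK.
apply: ae_imp (ae_and fg (@FTC1 R g (BLeft a) intgS loc)) _.
move=> x /= [fgx +] /andP[ax xb] => /(_ ax)[dG Gx].
rewrite fgx ?ltW//=; split => //.
set G := (G in derivable G _ _) in dG Gx *.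
apply: (@near_eq_is_derive _ _ _ (fun y => F a + G y)).
  near=> y; have : y \in `]a, b[ by near: y; apply: near_in_itvoo; rewrite in_itv/= ax.
  by rewrite in_itv/= => /andP[ay yb]; rewrite /= [RHS]FG// ay ltW.
rewrite -[g x]add0r; apply: is_deriveD.
by rewrite -Gx derive1E; apply: DeriveDef.
Unshelve. all: by end_near. Qed.

End CompletedDifferentiation.

(** * Upper tangents and countability of corners *)

Section Calculus.
Context {R : realType}.
Implicit Types (f g h : R -> R) (t d e r : R).

Lemma is_derive_linear_approx h t d e : is_derive t (1 : R) h d -> 0 < e ->
  \forall s \near t, `|h s - h t - d * (s - t)| <= e * `|s - t|.
Proof.
move=> [dh <-] e0.
have /cvgrPdist_le/(_ e e0) := dh.
rewrite near_withinE => /nbhs_ballP[r /= r0 Hr].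
exists r => //= s; rewrite /ball_ /= distrC => sr.
have [->|st] := eqVneq s t; first by rewrite !subrr mulr0 subr0 normr0 mulr0.
have st0 : s - t != 0 by rewrite subr_eq0.
have := Hr (s - t); rewrite /ball/= sub0r normrN => /(_ sr st0).
rewrite /GRing.scale/= mulr1 subrK => H.
rewrite -ler_pdivrMr ?normr_gt0// -normfV -normrM.
apply: le_trans H; rewrite -normrN le_eqVlt; apply/orP; left; apply/eqP.
by congr (`| _ |); rewrite /derive; field.
Qed.

(** [h - f] has a local minimum at [t]. Concretely, if the slopes differed, then [f] would exceed
    [h] on one side of [t]. *)
Lemma is_derive_touching f h t d d' : is_derive t (1 : R) f d ->
  is_derive t (1 : R) h d' -> (\forall s \near t, f s <= h s) -> f t = h t ->
  d = d'.
Proof.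
move=> fd hd' fh fht; apply/eqP/negPn/negP => dd'.
(* With a third of the slope gap as precision, the two approximation errors together stay below the
   gap. *)
have e0 : 0 < `|d - d'| / 3 by rewrite divr_gt0// normr_gt0 subr_eq0.
have := is_derive_linear_approx fd e0; have := is_derive_linear_approx hd' e0.
move=> near1 near2.
have /nbhs_ballP[r /= r0 Hr] : \forall s \near t, [/\ f s <= h s,
    `|f s - f t - d * (s - t)| <= `|d - d'| / 3 * `|s - t| &
    `|h s - h t - d' * (s - t)| <= `|d - d'| / 3 * `|s - t|].
  by near=> s; split; near: s.
(* The sign selects the side of [t] on which the tangent of [f] lies above that of [h]. *)
pose s := t + Num.sg (d - d') * (r / 2).
have st : s - t = Num.sg (d - d') * (r / 2) by rewrite /s addrAC subrr add0r.
have sgn : `|Num.sg (d - d')| = 1 :> R by rewrite normr_sg subr_eq0 dd'.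
have nst : `|s - t| = r / 2 by rewrite st normrM sgn mul1r gtr0_norm// divr_gt0.
have [|fhs] := Hr s.
  by rewrite /ball/= distrC nst ltr_pdivrMr// ltr_pMr// ltr1n.
rewrite nst !ler_norml => /andP[H1 H2] /andP[H3 H4].
have : (d - d') * (s - t) = `|d - d'| * (r / 2).
  by rewrite st normrEsg; ring.
have : 0 < `|d - d'| * (r / 2) by rewrite mulr_gt0 ?divr_gt0// normr_gt0 subr_eq0.
lra.
Unshelve. all: by end_near. Qed.

(** Concave corners, witnessed by a line of rational slope: two distinct slopes of majorants leave
    room for a rational between them, and rationality gives countability. *)
Definition corner_points f : set R :=
  [set t | exists q : rat, \forall s \near t, s != t ->
    f s - f t < ratr q * (s - t)].

(* At such a point s |-> f s - q s has a strict local maximum, and a function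
   has only countably many strict local maxima. *)
Lemma countable_corner_points f : countable (corner_points f).
Proof.
(* A corner is coded by its slope and a rational interval around it on which the strict inequality
   holds; other points get a dummy code. *)
have HQ t : exists q : rat * (rat * rat), corner_points f t ->
    [/\ ratr q.2.1 < t, t < ratr q.2.2 & forall s, ratr q.2.1 < s < ratr q.2.2 ->
      s != t -> f s - f t < ratr q.1 * (s - t)].
  have [[q /nbhs_ballP[e /= e0 He]]|nc] := pselect (corner_points f t); last first.
    by exists (0, (0, 0)).
  have [a] : exists a : rat, ratr a \in `]t - e, t[ by apply: rat_in_itvoo; lra.
  have [b] : exists b : rat, ratr b \in `]t, t + e[ by apply: rat_in_itvoo; lra.
  rewrite !in_itv/= => /andP[tb be] /andP[ea at_].
  exists (q, (a, b)) => _; split => //= s /andP[as_ sb]; apply: He.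
  by rewrite /ball/= ltr_norml; lra.
have /choice[q Hq] := HQ.
apply/countable_injP; exists (pickle \o q) => t t' /set_mem ct /set_mem ct'.
move=> /(pcan_inj pickleK) qtt'.
have [at_ tb Ht] := Hq t ct; have [at' tb' Ht'] := Hq t' ct'.
apply/eqP/negPn/negP => tt'.
(* Two points with one code each satisfy the strict inequality at the other; adding the two gives 0
   < 0. *)
have := Ht t'; rewrite qtt' at' tb' eq_sym => /(_ isT tt').
have := Ht' t; rewrite -qtt' at_ tb => /(_ isT tt').
lra.
Qed.

(** If one majorant had slope [c] and another a larger slope [c'], any rational [q] between would
    witness a corner: to the right of [t] the first majorant lies under the line of slope [q], to
    the left the second does. *)
Lemma corner_of_majorants f h h' t d d' :
  (\forall s \near t, f s <= h s) -> f t = h t -> is_derive t (1 : R) h d ->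
  (\forall s \near t, f s <= h' s) -> f t = h' t -> is_derive t (1 : R) h' d' ->
  ~ corner_points f t -> d = d'.
Proof.
suff main k k' c c' : (\forall s \near t, f s <= k s) -> f t = k t ->
    is_derive t (1 : R) k c -> (\forall s \near t, f s <= k' s) -> f t = k' t ->
    is_derive t (1 : R) k' c' -> ~ corner_points f t -> c' <= c.
  move=> fh fht hd fh' fht' hd' nc; apply/le_anti.
  rewrite (main h' h d' d)//=; exact: (main h h' d d').
move=> fk fkt kc fk' fkt' kc' nc; rewrite leNgt; apply/negP => cc'.
have [q] := rat_in_itvoo cc'; rewrite in_itv/= => /andP[cq qc'].
apply: nc; exists q.
have e1 : 0 < (ratr q - c) / 2 by rewrite divr_gt0// subr_gt0.
have e2 : 0 < (c' - ratr q) / 2 by rewrite divr_gt0// subr_gt0.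
have near1 := is_derive_linear_approx kc e1.
have near2 := is_derive_linear_approx kc' e2.
near=> s => st.
have ks : f s <= k s by near: s.
have k's : f s <= k' s by near: s.
have : `|k s - k t - c * (s - t)| <= (ratr q - c) / 2 * `|s - t| by near: s.
have : `|k' s - k' t - c' * (s - t)| <= (c' - ratr q) / 2 * `|s - t| by near: s.
rewrite -fkt -fkt' !ler_norml => /andP[_ H1] /andP[_ H2].
have := st; rewrite neq_lt => /orP[lt|lt].
- rewrite ltr0_norm ?subr_lt0// in H1 H2; clear H2.
  have : 0 < (c' - ratr q) * (t - s) by rewrite mulr_gt0 ?subr_gt0.
  lra.
- rewrite gtr0_norm ?subr_gt0// in H1 H2; clear H1.
  have : 0 < (ratr q - c) * (s - t) by rewrite mulr_gt0 ?subr_gt0.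
  lra.
Unshelve. all: by end_near. Qed.

End Calculus.

(** * Chain rule and gradient inequalities for convex functions *)

Section Differentials.
Context {R : realType}.

Lemma is_derive_comp_diff (V W : normedModType R) (F : V -> W) (f : R -> V) (t : R) (v : V) :
  is_derive t (1 : R) f v -> differentiable F (f t) ->
  is_derive t (1 : R) (F \o f) ('d F (f t) v).
Proof.
move=> [df <-] dF.
have df' : differentiable f t by exact/derivable1_diffP.
have dFf : differentiable (F \o f) t by exact: differentiable_comp.
apply: DeriveDef; first exact/derivable1_diffP.
by rewrite deriveE// diff_comp//= deriveE.
Qed.

Lemma diff_grad n (F : 'rV[R]_n -> R) (y v : 'rV[R]_n) : differentiable F y ->
  'd F y v = pairing (grad F y) v.
Proof.
move=> dF; rewrite {1}(row_sum_delta v) linear_sum /pairing mxE.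
apply: eq_bigr => i _; rewrite linearZ !mxE /= deriveE//.
by rewrite mulrC.
Qed.

Lemma pairingBl n (p q v : 'rV[R]_n) : pairing (p - q) v = pairing p v - pairing q v.
Proof. by rewrite /pairing mulmxBl !mxE. Qed.

Lemma is_derive_line (V : normedModType R) (u w : V) (t : R) :
  is_derive t (1 : R) (fun s : R => u + s *: w) w.
Proof.
have -> : (fun s : R => u + s *: w) = cst u \+ (fun s : R => s *: w) by [].
rewrite -[X in is_derive _ _ _ X]add0r; apply: is_deriveD.
have dw := is_diff_scalel t w.
apply: DeriveDef; first exact/derivable1_diffP.
by rewrite deriveE// diff_val scale1r.
Qed.

Lemma convex_grad_le n (F : 'rV[R]_n -> R) (p q : 'rV[R]_n) :
  (forall t, 0 < t < 1 -> F (t *: q + (1 - t) *: p) <= t * F q + (1 - t) * F p) ->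
  differentiable F p -> pairing (grad F p) (q - p) <= F q - F p.
Proof.
move=> convF dF.
pose k t := F (p + t *: (q - p)).
have dk : is_derive (0 : R) (1 : R) k (pairing (grad F p) (q - p)).
  rewrite -diff_grad//.
  have := is_derive_comp_diff (is_derive_line p (q - p) 0).
  by rewrite scale0r addr0; exact.
apply/ler_addgt0Pr => e e0.
have /nbhs_ballP[r /= r0 Hr] := is_derive_linear_approx dk e0.
(* Small enough for the linear approximation and strictly inside the unit interval for convexity. *)
pose t := Num.min (r / 2) (1 / 2) : R.
have t0 : 0 < t by rewrite lt_min !divr_gt0.
have t1 : t < 1 by rewrite gt_min; apply/orP; right; lra.
have tr : t < r by rewrite gt_min; apply/orP; left; lra.
have := Hr t; rewrite /ball/= sub0r normrN (gtr0_norm t0) => /(_ tr).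
rewrite /= subr0 (gtr0_norm t0) ler_norml => /andP[H _].
have := convF t; rewrite t0 t1 => /(_ isT).
rewrite (_ : _ *: q + _ = p + t *: (q - p)); last first.
  by rewrite scalerBr scalerBl scale1r addrCA addrA.
rewrite -/(k t); move: H; rewrite {2}/k scale0r addr0 => H1 H2.
rewrite -(ler_pM2l t0); lra.
Qed.

(** The weak gradient inequality at the midpoint [m] of [p] and [q] becomes strict through strict
    convexity at [m]. *)
Lemma strictly_convex_grad_lt n (F : 'rV[R]_n -> R) (p q : 'rV[R]_n) :
  (forall (u w : 'rV[R]_n) t, u != w -> 0 < t < 1 ->
     F (t *: u + (1 - t) *: w) < t * F u + (1 - t) * F w) ->
  differentiable F p -> q != p -> pairing (grad F p) (q - p) < F q - F p.
Proof.
move=> convF dF qp.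
pose m := 2^-1 *: q + (1 - 2^-1) *: p.
have h01 : 0 < (2^-1 : R) < 1 by rewrite invr_gt0 ltr0n /= invf_lt1 ?ltr1n.
have mp : m - p = 2^-1 *: (q - p).
  by apply/rowP => j; rewrite !mxE; ring.
have mp0 : m != p.
  by rewrite -subr_eq0 mp scaler_eq0 subr_eq0 negb_or qp andbT invr_eq0 pnatr_eq0.
have := @convex_grad_le n F p m; rewrite mp.
have -> : pairing (grad F p) (2^-1 *: (q - p)) = 2^-1 * pairing (grad F p) (q - p).
  by rewrite /pairing linearZ /= -scalemxAr mxE.
move=> /(_ _ dF) H; have := convF q p 2^-1 qp h01; rewrite -/m => Hm.
have {}H : 2^-1 * pairing (grad F p) (q - p) <= F m - F p.
  by apply: H => t t01; apply/ltW/convF.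
lra.
Qed.

End Differentials.

(** * Bounds for integrals, quadratic forms and a reparametrization of segments *)

Section Bounds.
Context {R : realType}.
Local Notation mu := (@lebesgue_measure R).

(* No measurability of f is needed: the lower integral defining \int is
   monotone for arbitrary nonnegative functions. *)
Lemma Rintegral_itv01_le (f : R -> R) (C : R) :
  (forall t, 0 <= t <= 1 -> 0 <= f t <= C) ->
  \int[mu]_(t in `[0, 1]) f t <= C.
Proof.
move=> fC.
have C0 : 0 <= C.
  have /andP[] : 0 <= f 0 <= C by apply: fC; rewrite lexx ler01.
  exact: le_trans.
have intC : (\int[mu]_(t in `[0%R, 1%R]) C%:E = C%:E)%E.
  rewrite integral_cst; last exact: measurable_itv.
  by rewrite /= lebesgue_measure_itv/= lte_fin ltr01 -EFinB subr0 mule1.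
have le : (\int[mu]_(t in `[0%R, 1%R]) (f t)%:E <= C%:E)%E.
  rewrite -intC ge0_integralE; last first.
    by move=> t /=; rewrite in_itv/= => /fC /andP[+ _]; rewrite lee_fin.
  rewrite ge0_integralE; last by move=> t _; rewrite lee_fin.
  apply: le_ereal_sup => _ [h /= Hh <-]; exists h => // t.
  apply: le_trans (Hh t) _; rewrite !patchE; case: ifPn => //.
  by rewrite inE /= in_itv/= => /fC /andP[_ +]; rewrite lee_fin.
rewrite /Rintegral -lee_fin fineK// ge0_fin_numE ?(le_lt_trans le) ?ltry//.
by apply: integral_ge0 => t /=; rewrite in_itv/= => /fC /andP[+ _]; rewrite lee_fin.
Qed.

(** The norms are maxima of absolute entries, so each of the [n * n] terms of the form is bounded by
    the norm of [G] times the squared norm of [u]. *)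
Lemma quadratic_form_le n (G : 'M[R]_n) (u : 'rV[R]_n) :
  (u *m G *m u^T) 0 0 <= (n * n)%:R * `|G| * `|u| ^+ 2.
Proof.
rewrite mxE.
apply: (@le_trans _ _ (\sum_(j < n) \sum_(i < n) `|G| * `|u| ^+ 2)).
  apply: ler_sum => j _; rewrite !mxE mulr_suml; apply: ler_sum => i _.
  apply: le_trans (ler_norm _) _; rewrite !normrM expr2 mulrAC mulrC.
  apply: ler_pM; rewrite ?mulr_ge0 ?entry_le_norm//.
  by apply: ler_pM; rewrite ?entry_le_norm.
by rewrite !sumr_const !card_ord -mulrnA -[leLHS]mulr_natl mulrA.
Qed.

(* arc maps the whole line into [-1, 1], with arc 0 = 0 and arc 1 = 1, so that a
   segment run at time arc t is a C^1 curve on R that never leaves the chart. *)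
Definition arc (t : R) : R := 2 * t / (1 + t ^+ 2).
Definition darc (t : R) : R := 2 * (1 - t ^+ 2) / (1 + t ^+ 2) ^+ 2.

Lemma arc_den_gt0 (t : R) : 0 < 1 + t ^+ 2.
Proof. by rewrite ltr_wpDr ?sqr_ge0. Qed.

Lemma arc_le1 t : `|arc t| <= 1.
Proof.
rewrite /arc normrM normfV (gtr0_norm (arc_den_gt0 t)).
rewrite ler_pdivrMr ?arc_den_gt0// mul1r ler_norml.
have := sqr_ge0 (t - 1); have := sqr_ge0 (t + 1); rewrite !expr2; lra.
Qed.

Lemma darc_le2 t : `|darc t| <= 2.
Proof.
have d0 : 0 < (1 + t ^+ 2) ^+ 2 by rewrite exprn_gt0 ?arc_den_gt0.
rewrite /darc normrM normfV (gtr0_norm d0) ler_pdivrMr//.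
rewrite normrM gtr0_norm// ler_pM2l// ler_norml.
have t0 := sqr_ge0 t; have : 0 <= (t ^+ 2) * t ^+ 2 by rewrite mulr_ge0.
rewrite (expr2 (1 + _)); lra.
Qed.

Lemma is_derive_arc t : is_derive t (1 : R) arc (darc t).
Proof.
have d0 : 1 + t ^+ 2 != 0 by rewrite gt_eqF ?arc_den_gt0.
rewrite /arc; apply: is_derive_eq.
by rewrite /darc /GRing.scale/=; field; exact: d0.
Qed.

Lemma darc_continuous : continuous darc.
Proof.
move=> t; apply: cvgM; first apply: cvgM; first exact: cvg_cst.
- by apply: cvgB; [exact: cvg_cst|exact: exprn_continuous].
- apply: cvgV; first by rewrite gt_eqF// exprn_gt0 ?arc_den_gt0.
  apply: (@cvg_comp _ _ _ (fun t : R => 1 + t ^+ 2) (fun x => x ^+ 2)).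
    by apply: cvgD; [exact: cvg_cst|exact: exprn_continuous].
  exact: exprn_continuous.
Qed.

End Bounds.

(** * Charts, short curves and the Riemannian distance *)

Section Charts.
Context {R : realType} {n : nat} {M : manifold R n}.
Implicit Types (c : chart R n M) (g : R -> M) (t : R).

Lemma transition_differentiable c c' x : atlas c -> atlas c' ->
  cdom c x -> cdom c' x -> differentiable (cmap c' \o cinv c) (cmap c x).
Proof.
move=> Ac Ac' cx c'x; have [+ _] := atlas_compatible Ac Ac' 1; apply.
by split; [exact: cmap_cod|rewrite cmapK].
Qed.

Lemma transition_derive_continuous c c' x (i : 'I_n) : atlas c -> atlas c' ->
  cdom c x -> cdom c' x ->
  {for cmap c x, continuous (fun y => 'D_(delta_mx 0 i) (cmap c' \o cinv c) y)}.
Proof.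
move=> Ac Ac' cx c'x; have [_ +] := atlas_compatible Ac Ac' 1; apply.
by split; [exact: cmap_cod|rewrite cmapK].
Qed.

Lemma near_cdom c g t : {for t, continuous g} -> cdom c (g t) ->
  \forall s \near t, cdom c (g s).
Proof. by move=> cg gt; apply: cg; apply: open_nbhs_nbhs; split => //; exact: cdom_open. Qed.

Lemma derivable_change_chart c c' g t : atlas c -> atlas c' ->
  {for t, continuous g} -> cdom c (g t) -> cdom c' (g t) ->
  derivable (cmap c \o g) t 1 -> derivable (cmap c' \o g) t 1.
Proof.
move=> Ac Ac' cg cgt c'gt dg.
apply: (@near_eq_derivable _ _ _ ((cmap c' \o cinv c) \o (cmap c \o g))).
  near=> s; rewrite /= cmapK//; near: s; exact: near_cdom.
have dg' : is_derive t (1 : R) (cmap c \o g) ('D_1 (cmap c \o g) t) by apply: DeriveDef.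
have [] // := is_derive_comp_diff dg' (transition_differentiable Ac Ac' cgt c'gt).
Unshelve. all: by end_near. Qed.

End Charts.

(** * Chart segments as smooth curves *)

Section Segments.
Context {R : realType} {n : nat} {M : riemannian_manifold R n}.
Variables (c : chart R n M) (y w : 'rV[R]_n).
Hypotheses (Ac : atlas c) (yw : forall s : R, `|s| <= 1 -> ccod c (y + s *: w)).

Let line (t : R) := y + arc t *: w.
Let seg (t : R) : M := cinv c (line t).

Let line_cod t : ccod c (line t). Proof. by apply: yw; exact: arc_le1. Qed.

Let seg_dom t : cdom c (seg t). Proof. exact/cinv_dom/line_cod. Qed.

Let cmap_seg t : cmap c (seg t) = line t. Proof. exact/cinvK/line_cod. Qed.

Let is_derive_seg t : is_derive t (1 : R) line (darc t *: w).
Proof.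
have dl := is_derive_line y w (arc t).
have dl' : differentiable (fun s : R => y + s *: w) (arc t).
  by apply/derivable1_diffP; case: dl.
have := is_derive_comp_diff (is_derive_arc t) dl'.
rewrite -[darc t]mulr1 linearZ /= -deriveE//.
by case: dl => _ ->; rewrite /GRing.scale/= mulr1.
Qed.

Let line_continuous : continuous line.
Proof.
move=> t; apply: differentiable_continuous; apply/derivable1_diffP.
by have [] := is_derive_seg t.
Qed.

Let seg_continuous : continuous seg.
Proof.
move=> t; apply: (@continuous_comp _ _ _ line (cinv c)); first exact: line_continuous.
exact/cinv_continuous/line_cod.
Qed.

Let is_derive_cmap_seg c' t : atlas c' -> cdom c' (seg t) ->
  is_derive t (1 : R) (cmap c' \o seg) ('d (cmap c' \o cinv c) (line t) (darc t *: w)).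
Proof.
move=> Ac' c't; apply: (is_derive_comp_diff (is_derive_seg t)).
by rewrite -cmap_seg; exact: transition_differentiable.
Qed.

Lemma segment_C1_curve : C1_curve seg.
Proof.
split; first exact: seg_continuous.
move=> c' Ac' t c't; split; first by have [] := is_derive_cmap_seg Ac' c't.
(* Smoothness of the atlas provides continuity of partial derivatives only, so the velocity is
   expanded in them. *)
pose F s := darc s *: \sum_(i < n) w 0 i *: 'D_(delta_mx 0 i) (cmap c' \o cinv c) (line s).
have FE : {near t, F =1 derive1 (cmap c' \o seg)}.
  near=> s.
  have c's : cdom c' (seg s).
    by near: s; apply: near_cdom => //; exact: seg_continuous.
  rewrite derive1E; have [_ ->] := is_derive_cmap_seg Ac' c's.
  rewrite linearZ /F /=; congr (_ *: _).
  rewrite {2}(row_sum_delta w) linear_sum /=; apply: eq_bigr => i _.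
  rewrite linearZ /= deriveE// -cmap_seg; exact: transition_differentiable.
have Ft : F t = derive1 (cmap c' \o seg) t := nbhs_singleton FE.
rewrite /continuous_at /prop_for -Ft.
apply: cvg_trans; first exact: (near_eq_cvg FE).
apply: cvgZ; first exact: darc_continuous.
apply: cvg_big => [|i _]; first exact: add_continuous.
apply: cvgZ; first exact: cvg_cst.
apply: (@continuous_comp _ _ _ line (fun z => 'D_(delta_mx 0 i) (cmap c' \o cinv c) z)).
  exact: line_continuous.
by rewrite -cmap_seg; exact: transition_derive_continuous.
Unshelve. all: by end_near. Qed.

(** [velocity] is read in a preferred chart that changes with [t]. The Jacobian brings it back to
    the fixed chart [c], where the Gram matrix depends continuously on the point. *)
Lemma segment_speed t :
  tnorm (seg t) (velocity seg t) = Num.sqrt (darc t ^+ 2 *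
    (w *m (let x := seg t in let J := chart_change c (chart_at x) x in
       J *m gram x *m J^T) *m w^T) 0 0).
Proof.
rewrite /tnorm /velocity derive1E.
have [_ ->] := is_derive_cmap_seg (chart_at_atlas (seg t)) (chart_at_dom (seg t)).
congr Num.sqrt; rewrite /= /chart_change cmap_seg.
set J := 'J _ _.
rewrite -deriveE; last first.
  by rewrite -cmap_seg; apply: transition_differentiable => //;
    [exact: chart_at_atlas|exact: chart_at_dom].
rewrite deriveEjacobian -/J; last first.
  by rewrite -cmap_seg; apply: transition_differentiable => //;
    [exact: chart_at_atlas|exact: chart_at_dom].
rewrite -scalemxAl linearZ /= -!scalemxAl -scalemxAr scalerA trmx_mul !mulmxA.
by rewrite mxE expr2.
Qed.

End Segments.

(** * Comparison of the Riemannian distance with the topology *)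

Section Distance.
Context {R : realType} {n : nat} {M : riemannian_manifold R n}.
Implicit Types (x y : M).

Lemma pw_C1_path_ge0 x y l : pw_C1_path x y l -> 0 <= l.
Proof.
elim=> [//|g z k _ _ k0]; rewrite addr_ge0// /curve_length.
by apply: Rintegral_ge0 => t _; exact: sqrtr_ge0.
Qed.

Lemma rdist_le x y l : pw_C1_path x y l -> rdist x y <= l.
Proof. by move=> xyl; apply: ge_inf => //; exists 0 => k; exact: pw_C1_path_ge0. Qed.

(** Metric balls are neighbourhoods: near [x] the Gram matrix in a chart is bounded, so the chart
    segment from [x] to [z] has length at most a constant times the coordinate distance. *)
Lemma near_rdist_lt x (r : R) : 0 < r -> \forall z \near x, rdist x z < r.
Proof.
move=> r0; pose c := chart_at x; pose y := cmap c x.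
have Ac : atlas c := chart_at_atlas x; have cx : cdom c x := chart_at_dom x.
have cy : ccod c y by exact: cmap_cod.
pose G (u : 'rV[R]_n) := let z := cinv c u in
  let J := chart_change c (chart_at z) z in J *m gram z *m J^T.
have Gy : {for y, continuous G} := gram_smooth Ac 0%N _ cy.
pose B := `|G y| + 1.
have nearB : \forall z \near y, `|G z| <= B.
  have /cvgrPdist_le/(_ 1 ltr01) := Gy; apply: filterS => z /= Gyz.
  by rewrite /B -lerBlDl; apply: le_trans Gyz; rewrite distrC lerB_dist.
have nearC : \forall z \near y, ccod c z.
  by apply: open_nbhs_nbhs; split => //; exact: ccod_open.
have /nbhs_ballP[d /= d0 Hd] : \forall z \near y, ccod c z /\ `|G z| <= B.
  by near=> z; split; near: z.
have B0 : 0 <= B by rewrite addr_ge0.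
(* The 4 bounds the square of [darc], and the remaining factors come from [quadratic_form_le]. *)
pose K := 4 * (n * n)%:R * B.
have K0 : 0 <= K by rewrite !mulr_ge0.
(* The added 1 keeps the divisor positive when [n] is 0 and [K] vanishes. *)
have K1 : 0 < Num.sqrt K + 1 by rewrite ltr_wpDl ?sqrtr_ge0.
have e0 : 0 < Num.min d (r / (Num.sqrt K + 1)) by rewrite lt_min d0 divr_gt0.
have cc : {for x, continuous (cmap c)} by exact: cmap_continuous.
have near1 : \forall z \near x, cdom c z.
  by apply: open_nbhs_nbhs; split => //; exact: cdom_open.
have near2 : \forall z \near x, `|y - cmap c z| < Num.min d (r / (Num.sqrt K + 1)).
  by have /cvgrPdist_lt/(_ _ e0) := cc.
near=> z.
have cz : cdom c z by near: z.
have : `|y - cmap c z| < Num.min d (r / (Num.sqrt K + 1)) by near: z.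
rewrite distrC lt_min => /andP[wd wr].
pose w := cmap c z - y.
have Hw (s : R) : `|s| <= 1 -> ccod c (y + s *: w) /\ `|G (y + s *: w)| <= B.
  move=> s1; apply: Hd; rewrite -ball_normE /ball_ /=.
  rewrite opprD addrA subrr add0r normrN normrZ.
  by apply: le_lt_trans wd; rewrite -[leRHS]mul1r ler_wpM2r.
have yw (s : R) : `|s| <= 1 -> ccod c (y + s *: w) by move=> /Hw[].
pose seg t := cinv c (y + arc t *: w).
have seg0 : seg 0 = x by rewrite /seg /arc mulr0 mul0r scale0r addr0 cmapK.
have seg1 : seg 1 = z.
  rewrite /seg /arc expr1n mulr1 divff; last by rewrite pnatr_eq0.
  by rewrite scale1r addrC subrK cmapK.
have path : pw_C1_path x z (curve_length seg + 0).
  by rewrite -seg0 -seg1; apply: pw_cons; [exact: segment_C1_curve|exact: pw_nil].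
apply: le_lt_trans (rdist_le path) _; rewrite addr0.
apply: (@le_lt_trans _ _ (Num.sqrt K * `|w|)); last first.
  apply: (@le_lt_trans _ _ ((Num.sqrt K + 1) * `|w|)).
    by rewrite ler_wpM2r// lerDl.
  by rewrite mulrC -ltr_pdivlMr.
apply: Rintegral_itv01_le => t t01; rewrite sqrtr_ge0/= segment_speed//.
have <- : Num.sqrt (K * `|w| ^+ 2) = Num.sqrt K * `|w|.
  by rewrite sqrtrM// sqrtr_sqr normr_id.
apply: ler_wsqrtr.
have [_ GB] := Hw _ (arc_le1 t).
have q := quadratic_form_le (G (y + arc t *: w)) w.
have {q} : (w *m G (y + arc t *: w) *m w^T) 0 0 <= (n * n)%:R * B * `|w| ^+ 2.
  by apply: le_trans q _; rewrite ler_wpM2r ?sqr_ge0// ler_wpM2l.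
have d4 : darc t ^+ 2 <= 4.
  have := darc_le2 t; rewrite ler_norml => /andP[lo hi].
  have : 0 <= (2 - darc t) * (2 + darc t) by rewrite mulr_ge0//; lra.
  rewrite expr2; lra.
set q := (_ *m _) 0 0 => qB.
apply: (@le_trans _ _ (darc t ^+ 2 * ((n * n)%:R * B * `|w| ^+ 2))).
  by rewrite ler_wpM2l// sqr_ge0.
have -> : K * `|w| ^+ 2 = 4 * ((n * n)%:R * B * `|w| ^+ 2) by rewrite /K; ring.
by rewrite ler_wpM2r// !mulr_ge0// sqr_ge0.
Unshelve. all: by end_near. Qed.

Lemma rdistxx_lt x (r : R) : 0 < r -> rdist x x < r.
Proof. by move=> /near_rdist_lt/nbhs_singleton. Qed.

End Distance.

(** * Superdifferentials along curves *)

Section Superdifferential.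
Context {R : realType} {n : nat} {M : riemannian_manifold R n}.

(** The function [h] is [psi \o g] for a test function [psi] with differential [q]. Since metric
    balls are neighbourhoods, [g] stays in the domain of comparison for times near [t]. *)
Lemma superdifferential_curve (phi : M -> R) (g : R -> M) (t : R) (q v : 'rV[R]_n) :
  superdifferential phi (g t) q -> {for t, continuous g} -> has_velocity g t v ->
  exists h : R -> R, [/\ \forall s \near t, phi (g s) <= h s, phi (g t) = h t &
    is_derive t (1 : R) h (pairing q v)].
Proof.
move=> [r [psi [r0 C1psi phipsi psix ->]]] cg vg.
pose c := chart_at (g t).
have Ac : atlas c := chart_at_atlas _; have cgt : cdom c (g t) := chart_at_dom _.
exists (psi \o g); split; last 2 first.
- by rewrite /= psix.
- have dpsi : differentiable (psi \o cinv c) (cmap c (g t)).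
    have [+ _] := C1psi c Ac; apply; split; first exact: cmap_cod.
    by rewrite /= cmapK//; exact: rdistxx_lt.
  rewrite /differential -/c -diff_grad//.
  apply: (@near_eq_is_derive _ _ _ ((psi \o cinv c) \o (cmap c \o g))).
    near=> s; rewrite /= cmapK//; near: s; exact: near_cdom.
  exact: is_derive_comp_diff.
- have nr : \forall s \near t, rdist (g t) (g s) < r.
    exact: (cg _ (near_rdist_lt (g t) r0)).
  by near=> s; apply: phipsi; near: s.
Unshelve. all: by end_near. Qed.

Lemma within_continuous_interior (I : interval R) (g : R -> M) (t : R) :
  {within [set` I], continuous g} -> nbhs t [set` I] -> {for t, continuous g}.
Proof.
move=> cg It; have := cg t.
rewrite /prop_for /continuous_at /nbhs /= -nbhs_subspace_in; last exact: nbhs_singleton It.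
by rewrite within_interior.
Qed.

End Superdifferential.

(** * Interior points of intervals *)

Section Interiors.
Context {R : realType}.
Local Notation mu := (@lebesgue_measure R).

(** Only finite endpoints can fail, and there are at most two of them. *)
Lemma itv_interior_ae (I : interval R) :
  {ae mu, forall t, t \in I -> nbhs t [set` I]}.
Proof.
have lower (l : itv_bound R) : {ae mu, forall t, t \in Interval l +oo%O ->
    \forall s \near t, s \in Interval l +oo%O}.
  case: l => [b a|b]; last first.
    apply: aeW => t tI; near=> s.
    by case: b tI; rewrite ?in_itv//= itv_boundlr/=.
  apply: ae_imp (ae_neq a) _ => t ta; rewrite in_itv/= andbT => at_.
  have {}at_ : a < t by rewrite lt_neqAle eq_sym ta/=; case: (b) at_ => // /ltW.
  near=> s; have as_ : a < s by near: s; exact: lt_nbhsr.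
  by rewrite in_itv/= andbT; case: (b) => //=; exact: ltW.
have upper (l : itv_bound R) : {ae mu, forall t, t \in Interval -oo%O l ->
    \forall s \near t, s \in Interval -oo%O l}.
  case: l => [b a|b]; last first.
    apply: aeW => t tI; near=> s.
    by case: b tI; rewrite ?in_itv//= itv_boundlr/=.
  apply: ae_imp (ae_neq a) _ => t ta; rewrite in_itv/= => at_.
  have {}at_ : t < a by rewrite lt_neqAle ta/=; case: (b) at_ => // /ltW.
  near=> s; have as_ : s < a by near: s; exact: lt_nbhsl.
  by rewrite in_itv/=; case: (b) => //=; exact: ltW.
case: I => l u; apply: ae_imp (ae_and (lower l) (upper u)) _ => t [Hl Hu].
rewrite itv_boundlr => /andP[lt tu].
have {}Hl := Hl _; have {}Hu := Hu _.
near=> s; rewrite /= itv_boundlr.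
have : s \in Interval l +oo%O.
  by near: s; apply: Hl; rewrite itv_boundlr lt/=.
have : s \in Interval -oo%O u.
  by near: s; apply: Hu; rewrite itv_boundlr tu/=.
by rewrite !itv_boundlr => /andP[_ ->] /andP[-> _].
Unshelve. all: by end_near. Qed.

End Interiors.

(** * Maximal slope curves *)

Section Characteristics.
Context {R : realType} {n : nat} {M : riemannian_manifold R n}.
Local Notation mu := (@lebesgue_measure R).

Lemma pairingC (p v : 'rV[R]_n) : pairing p v = pairing v p.
Proof. by rewrite /pairing !mxE; apply: eq_bigr => i _; rewrite !mxE mulrC. Qed.

(** Absolute continuity holds on segments mapped into one chart. Countably many segments with
    rational endpoints suffice, as continuity puts every interior time inside one of them. *)
Lemma locally_AC_velocity (I : interval R) (g : R -> M) : locally_AC I g ->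
  {ae mu, forall t, t \in I -> has_velocity g t (velocity g t)}.
Proof.
move=> [cg ACg].
have pieces (ab : rat * rat) : {ae mu, forall t : R,
    (exists c, [/\ atlas c, ratr ab.1 \in I, ratr ab.2 \in I &
      forall s : R, ratr ab.1 <= s <= ratr ab.2 -> cdom c (g s)]) ->
    ratr ab.1 < t < ratr ab.2 ->
    exists c, [/\ atlas c, cdom c (g t) & derivable (cmap c \o g) t 1]}.
  have [[c [Ac aI bI cab]]|nc] := pselect (exists c, [/\ atlas c,
    ratr ab.1 \in I, ratr ab.2 \in I &
    forall s : R, ratr ab.1 <= s <= ratr ab.2 -> cdom c (g s)]); last first.
    by apply: aeW => t /nc.
  have [ab12|ab21] := ltP (ratr ab.1 : R) (ratr ab.2); last first.
    by apply: aeW => t _ /andP[at_ tb]; have := lt_trans at_ tb; rewrite ltNge ab21.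
  have := absolutely_continuous_row_derivable ab12 (ACg c Ac _ _ aI bI cab).
  move=> /ae_imp; apply=> t dt _ tab; exists c; split => //; last exact: dt.
  by apply: cab; case/andP: tab => /ltW -> /ltW ->.
apply: ae_imp (ae_and (itv_interior_ae I) (ae_forall_countable pieces)) _.
move=> t [tint piecest] tI.
have It := tint tI; have ct := within_continuous_interior cg It.
pose c := chart_at (g t).
have cgt : cdom c (g t) := chart_at_dom _.
have nc := near_cdom ct cgt.
have /nbhs_ballP[e /= e0 He] : \forall s \near t, s \in I /\ cdom c (g s).
  by near=> s; split; near: s.
have [a] : exists a : rat, ratr a \in `]t - e, t[ by apply: rat_in_itvoo; lra.
have [b] : exists b : rat, ratr b \in `]t, t + e[ by apply: rat_in_itvoo; lra.
rewrite !in_itv/= => /andP[tb be] /andP[ea at_].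
have near_t s : ratr a <= s <= ratr b -> s \in I /\ cdom c (g s).
  by move=> /andP[as_ sb]; apply: He; rewrite /ball/= ltr_norml; lra.
have [||c' [Ac' c't dc']] := piecest (a, b).
- exists c; split => /=.
  + exact: chart_at_atlas.
  + by have [] := near_t (ratr a); [rewrite lexx /=; lra|].
  + by have [] := near_t (ratr b); [rewrite lexx andbT; lra|].
  + by move=> s /near_t[].
- by rewrite /= at_.
have Ac : atlas c by exact: chart_at_atlas.
apply: DeriveDef; last by rewrite /velocity derive1E.
(* The chart [c'] was chosen for the whole rational segment; the velocity is defined in the
   preferred chart at [g t]. *)
exact: derivable_change_chart Ac' Ac ct c't cgt dc'.
Unshelve. all: by end_near. Qed.

(** [get] meets its specification once a minimizer [q] is exhibited, and two minimizers give [H x]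
    the same value. *)
Lemma psharp_minimizes (H : M -> 'rV[R]_n -> R) (phi : M -> R) (x : M) (q : 'rV[R]_n) :
  superdifferential phi x q ->
  (forall q', superdifferential phi x q' -> H x q <= H x q') ->
  superdifferential phi x (psharp H phi x) /\ H x (psharp H phi x) = H x q.
Proof.
move=> Dq qmin.
have [Dp pmin] : superdifferential phi x (psharp H phi x) /\
    forall q', superdifferential phi x q' -> H x (psharp H phi x) <= H x q'.
  by apply: (@getPex _ (fun q => superdifferential phi x q /\
    forall q', superdifferential phi x q' -> H x q <= H x q')); exists q.
by split => //; apply/le_anti; rewrite pmin ?qmin.
Qed.

Lemma maximal_slope_curve_psharp (H : M -> 'rV[R]_n -> R) (phi : M -> R)
    (p : M -> 'rV[R]_n) (I : interval R) (g : R -> M) : selection phi p ->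
  maximal_slope_curve H phi p I g -> maximal_slope_curve H phi (psharp H phi) I g.
Proof.
move=> psel [ACg eqn]; split => // t1 t2 t1I t2I t12.
have [intf intE] := eqn t1 t2 t1I t2I t12.
pose f s := (lagrangian H (g s) (velocity g s) + (H (g s) (p (g s)))%:E)%E.
pose f' s := (lagrangian H (g s) (velocity g s) +
  (H (g s) (psharp H phi (g s)))%:E)%E.
(* The integrands differ only in the term with [H], so it remains to see that [p] and [psharp] give
   it the same value almost everywhere. *)
suff ff' : {ae mu, forall t, t1 < t < t2 -> f t = f' t}.
  have [intf' int'E] := completed_integrable_ae_eq intf ff'.
  by split => //; rewrite intE; exact: int'E.
have inI y : t1 <= y <= t2 -> y \in I.
  by move=> /andP[? ?]; apply: (@interval_is_interval _ I t1 t2) => //; apply/andP.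
have FE y : t1 < y <= t2 -> (phi (g y) - phi (g t1))%:E =
    (\int[@completed_lebesgue_measure R]_(s in `[t1, y]) f s)%E.
  move=> /andP[t1y yt2]; have [|_ ->] := eqn t1 y t1I _ t1y => //.
  by apply: inI; rewrite ltW.
have := completed_integral_is_derive t12 intf FE.
move=> df; apply: ae_imp (ae_and df (ae_and (locally_AC_velocity ACg) (itv_interior_ae I))) _.
move=> t [+ [+ +]] t12t; have tI : t \in I.
  by apply: inI; case/andP: t12t => /ltW -> /ltW ->.
move=> /(_ t12t)[ffin dft] /(_ tI) vel /(_ tI) It.
have ct := within_continuous_interior ACg.1 It.
set x := g t in vel *; set v := velocity g t in vel.
(* [fine (f t)] is the derivative of [phi \o g] at [t], and every [q] yields a function touching
   from above. *)
have dir q : superdifferential phi x q -> fine (f t) = pairing q v.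
  move=> Dq; have [h [fh fht dh]] := superdifferential_curve Dq ct vel.
  exact: is_derive_touching dft dh fh fht.
have Dp := psel x.
have ftE : f t = (pairing (p x) v)%:E by rewrite -(dir _ Dp) fineK.
(* Finiteness of [f t] forces the Lagrangian to be finite, and [p x] then attains the supremum
   defining it. *)
have LE : lagrangian H x v = (pairing (p x) v - H x (p x))%:E.
  move: ftE; rewrite /f -/x -/v; case: (lagrangian H x v) => // l [<-].
  by rewrite addrK.
rewrite /f /f'; congr (_ + _)%E; congr EFin; rewrite -/x.
have [|//] := psharp_minimizes Dp (H := H).
  move=> q Dq.
  (* Any [q] competes in that supremum with the same pairing, so [H x (p x)] is at most [H x q]. *)
  have : ((pairing q v - H x q)%:E <= lagrangian H x v)%E.
    by apply: ereal_sup_ubound; exists q.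
  rewrite LE lee_fin -(dir _ Dp) -(dir _ Dq); lra.
Qed.

Lemma inclusion_solution_psharp (H : M -> 'rV[R]_n -> R) (phi : M -> R)
    (I : interval R) (g : R -> M) : admissible H ->
  solves_inclusion (fun x => ham_p H x @` superdifferential phi x) I g ->
  solves_ode (fun x => ham_p H x (psharp H phi x)) I g.
Proof.
move=> adm [ACg sol]; split => //.
have corners := countable_ae (countable_corner_points (phi \o g)).
apply: ae_imp (ae_and sol (ae_and (itv_interior_ae I) corners)) _.
move=> t [+ [+ nc]] tI => /(_ tI)[v [q Dq qv] vel] /(_ tI) It.
have ct := within_continuous_interior ACg.1 It.
set x := g t in Dq qv vel *.
have const q' : superdifferential phi x q' -> pairing q' v = pairing q v.
  move=> Dq'; have [h [fh fht dh]] := superdifferential_curve Dq ct vel.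
  have [h' [fh' fht' dh']] := superdifferential_curve Dq' ct vel.
  exact: corner_of_majorants fh' fht' dh' fh fht dh nc.
(* Since [v] is the gradient of [H x] at [q] and pairs equally with [q] and [q'], the first-order
   term of the strict gradient inequality vanishes. *)
have qlt q' : superdifferential phi x q' -> q' != q -> H x q < H x q'.
  move=> Dq' q'q.
  have := strictly_convex_grad_lt (ham_strictly_convex adm (x))
    (ham_differentiable adm x q) q'q.
  by rewrite -/(ham_p H x q) qv pairingC pairingBl (const _ Dq') subrr subr_gt0.
have [|Dp pE] := psharp_minimizes Dq (H := H).
  by move=> q' Dq'; have [->|/(qlt _ Dq')/ltW] := eqVneq q' q.
(* Strictness makes [q] the only minimizer, so the covectors themselves agree and not merely their
   values under [H x]. *)
have -> : psharp H phi x = q.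
  by apply/eqP/negPn/negP => /(qlt _ Dp); rewrite pE ltxx.
by rewrite qv.
Qed.

End Characteristics.

Theorem proposition3p4 (R : realType) (n : nat) (M : riemannian_manifold R n)
  (compactM : compact [set: M]) (connectedM : connected [set: M])
  (phi : M -> R) (phi_semiconcave : semiconcave phi)
  (H : M -> 'rV[R]_n -> R) (H_admissible : admissible H)
  (p : M -> 'rV[R]_n) (p_borel : borel_section p) (p_sel : selection phi p)
  (I : interval R) (gamma : R -> M) :
  (maximal_slope_curve H phi p I gamma ->
     strict_singular_characteristic H phi I gamma) /\
  (solves_inclusion (fun x => ham_p H x @` superdifferential phi x) I gamma ->
     solves_ode (fun x => ham_p H x (psharp H phi x)) I gamma).
Proof.
split; first exact: maximal_slope_curve_psharp.
exact: inclusion_solution_psharp.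
Qed.
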